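(* A constellation $[\mathbb{X},\mathbb{P}]$ (natural binary code labeling, bit probabilities $P_{C_k}(0)\in(0,1)$) is first-order optimal if and only if the Hadamard transform $\tilde{\mathbb{X}}$ of $\mathbb{X}$ satisfies both $$\tilde{\boldsymbol{x}}_0=\sum_{k=0}^{m-1}\tilde{\boldsymbol{x}}_{2^k}\big(P_{C_k}(1)-P_{C_k}(0)\big)$$ and $$\tilde{\boldsymbol{x}}_j=\boldsymbol{0}\quad\text{for all } j\notin\{0\}\cup\{1,2,4,\ldots,M/2\}.$$
   Context: Let $m\ge1$, $M=2^m$, $N\ge1$. For $0\le i\le M-1$, $n_{i,k}\in\{0,1\}$ is the $k$-th bit of $i$ ($i=\sum_kn_{i,k}2^k$). A constellation $[\mathbb{X},\mathbb{P}]$ consists of an alphabet $\mathbb{X}$ with rows $\boldsymbol{x}_0,\ldots,\boldsymbol{x}_{M-1}\in\mathbb{R}^N$, symbol $\boldsymbol{x}_i$ labeled $(n_{i,0},\ldots,n_{i,m-1})$, and distribution $P_i=\prod_kP_{C_k}(n_{i,k})$, $P_{C_k}(1)=1-P_{C_k}(0)$; i.e. independent bits $C_k$ with $\Pr(C_k=u)=P_{C_k}(u)$ select $\boldsymbol{X}=\boldsymbol{x}_i$, $i=\sum_kC_k2^k$. Hadamard transform: $\tilde{\boldsymbol{x}}_i=\frac1M\sum_j\boldsymbol{x}_jh_{i,j}$, $h_{i,j}=\prod_k(-1)^{n_{i,k}n_{j,k}}$. Channel: $\boldsymbol{Y}=\boldsymbol{H}\circ\boldsymbol{X}+\boldsymbol{Z}$,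 $\boldsymbol{Z}$ zero-mean Gaussian with variance $N_0/2$ per dimension, $\boldsymbol{H}$ real fading vector with common marginal pdf $p_H$, known at the receiver (standard regularity conditions assumed). $E_s=\mathbb{E}[\|\boldsymbol{X}\|^2]$, $\mathrm{SNR}=\mathbb{E}[H^2]E_s/N_0$. BICM-GMI: $I(\mathrm{SNR})=\sum_kI(C_k;\boldsymbol{Y}\mid\boldsymbol{H})$ in bits, as a function of SNR; $\alpha=\frac{dI}{d\,\mathrm{SNR}}\big|_{\mathrm{SNR}=0}$. The constellation is first-order optimal (FOO) if $\alpha=\log_2 e$ (i.e. BICM achieves the Shannon limit $-1.59$ dB). *)

(* Defs.v *)
From HB Require Import structures.
From mathcomp Require Import all_boot all_order all_algebra.
From mathcomp Require Import all_classical all_reals all_analysis.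
Set Implicit Arguments. Unset Strict Implicit. Unset Printing Implicit Defensive.
Import Order.TTheory GRing.Theory Num.Theory.
Import numFieldNormedType.Exports.
Local Open Scope classical_set_scope.
Local Open Scope ring_scope.

Section BICM.
Variable R : realType.

Definition bit (i k : nat) : bool := odd (i %/ 2 ^ k).

Definition log2 (x : R) : R := ln x / ln 2.

(* Bit probabilities: p k = P_{C_k}(0); PC p k u = P_{C_k}(u). *)
Definition PC (m : nat) (p : 'I_m -> R) (k : 'I_m) (u : bool) : R :=
  if u then 1 - p k else p k.

Definition Psym (m : nat) (p : 'I_m -> R) (i : nat) : R :=
  \prod_(k < m) PC p k (bit i k).

Definition hadh (m : nat) (i j : nat) : R :=
  \prod_(k < m) (-1) ^+ (bit i k && bit j k).

Definition hadamard (m N : nat) (X : 'M[R]_(2 ^ m, N)) (j : nat) : 'rV[R]_N :=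
  (2 ^ m)%:R^-1 *: \sum_(i < 2 ^ m) hadh m j i *: row i X.

Definition Es (m N : nat) (X : 'M[R]_(2 ^ m, N)) (p : 'I_m -> R) : R :=
  \sum_(i < 2 ^ m) Psym p i * \sum_(n < N) X i n ^+ 2.

(* Iterated Lebesgue integral over R^n of F : (nat -> R) -> R, integrating
   coordinates 0 .. n-1 (coordinates >= n are set to 0). *)
Definition upd (y : nat -> R) (n : nat) (t : R) : nat -> R :=
  fun j => if j == n then t else y j.

Fixpoint iint (n : nat) (F : (nat -> R) -> R) : R :=
  match n with
  | 0 => F (fun _ => 0)
  | n'.+1 => Rintegral (@lebesgue_measure R) setT
               (fun t => iint n' (fun y => F (upd y n' t)))
  end.

Definition intRN (N : nat) (f : 'rV[R]_N -> R) : R :=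
  iint N (fun y => f (\row_(n < N) y n)).

(* Density of zero-mean Gaussian noise, variance N0/2 per dimension *)
Definition gauss (N : nat) (N0 : R) (z : 'rV[R]_N) : R :=
  \prod_(n < N) ((Num.sqrt (pi * N0))^-1 * expR (- (z 0 n) ^+ 2 / N0)).

Definition hprod (N : nat) (h x : 'rV[R]_N) : 'rV[R]_N :=
  \row_(n < N) (h 0 n * x 0 n).

Definition py (m N : nat) (X : 'M[R]_(2 ^ m, N)) (p : 'I_m -> R) (N0 : R)
    (h y : 'rV[R]_N) : R :=
  \sum_(i < 2 ^ m) Psym p i * gauss N0 (y - hprod h (row i X)).

Definition pycond (m N : nat) (X : 'M[R]_(2 ^ m, N)) (p : 'I_m -> R) (N0 : R)
    (k : 'I_m) (u : bool) (h y : 'rV[R]_N) : R :=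
  \sum_(i < 2 ^ m | bit i k == u)
     (Psym p i / PC p k u) * gauss N0 (y - hprod h (row i X)).

Definition MIbit (m N : nat) (X : 'M[R]_(2 ^ m, N)) (p : 'I_m -> R) (N0 : R)
    (k : 'I_m) (h : 'rV[R]_N) : R :=
  \sum_(u : bool) PC p k u *
     intRN (fun y => pycond X p N0 k u h y *
                     log2 (pycond X p N0 k u h y / py X p N0 h y)).

(* E[H^2] (common to all components) *)
Definition EH2 (d : measure_display) (T : measurableType d)
    (P : probability T R) (H : nat -> T -> R) : R :=
  Rintegral P setT (fun t => H 0%N t ^+ 2).

(* BICM-GMI as a function of SNR:  I(SNR) = sum_k I(C_k; Y | H), with
   N0 = E[H^2] E_s / SNR; by convention I(0) = 0 (and I = 0 for SNR < 0). *)
Definition Ibicm (m N : nat) (X : 'M[R]_(2 ^ m, N)) (p : 'I_m -> R)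
    (d : measure_display) (T : measurableType d) (P : probability T R)
    (H : nat -> T -> R) (snr : R) : R :=
  if 0 < snr then
    let N0 := EH2 P H * Es X p / snr in
    \sum_(k < m) Rintegral P setT
        (fun t => MIbit X p N0 k (\row_(n < N) H n t))
  else 0.

(* First-order optimality: the right derivative of I at SNR = 0 exists and
   equals log2 e = 1 / ln 2. *)
Definition FOO (m N : nat) (X : 'M[R]_(2 ^ m, N)) (p : 'I_m -> R)
    (d : measure_display) (T : measurableType d) (P : probability T R)
    (H : nat -> T -> R) : Prop :=
  (fun s => (Ibicm X p P H s - Ibicm X p P H 0) / s) @ 0^'+ --> (ln 2 : R)^-1.

End BICM.

(* Main.v *)
(* Tilting the noise density by a_i = h o x_i gives the likelihood ratios
   L_i = exp((2 y.a_i - |a_i|^2) / N0), whose products have explicit Gaussian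
   integrals. Expanding a ln(a/b) to second order, where a and b are the mixtures
   of the L_i under C_k = u and unconditionally, sandwiches the information of bit
   k between explicit combinations of Gaussians and yields
     I(C_k; Y | H = h) = N0^-1 Var(E[h o X | C_k]) log2 e + O(v min(1, sqrt v))
   with v = |h|^2 / N0; the remainder is linear in v for large v because one bit
   carries bounded information. Dominated convergence in H, with E[|H|^2] finite,
   then gives alpha = log2 e * sum_k Var(E[X | C_k]) / E_s.
   Finally, E_s is the sum of |E X|^2, of sum_k Var(E[X | C_k]), and of the energy
   of the interactions, so alpha = log2 e iff X has mean zero and is a sum of
   functions of single bits; in the Hadamard basis these are the two conditions. *)

Require Import Defs.
From HB Require Import structures.
From mathcomp Require Import all_boot all_order all_algebra.
From mathcomp Require Import all_classical all_reals all_analysis.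
From mathcomp Require Import measurable_realfun.
From mathcomp Require Import ring lra.
Set Implicit Arguments. Unset Strict Implicit. Unset Printing Implicit Defensive.
Import Order.TTheory GRing.Theory Num.Theory.
Import numFieldNormedType.Exports.
Local Open Scope classical_set_scope.
Local Open Scope ring_scope.

(** * Binary digits of natural numbers *)

Lemma bitS (i k : nat) : bit i k.+1 = bit i./2 k.
Proof. by rewrite /bit expnS divnMA divn2. Qed.

Lemma bit0 (i : nat) : bit i 0 = odd i.
Proof. by rewrite /bit expn0 divn1. Qed.

Lemma bit_ext (m i j : nat) : (i < 2 ^ m)%N -> (j < 2 ^ m)%N ->
  (forall k, (k < m)%N -> bit i k = bit j k) -> i = j.
Proof.
elim: m i j => [|m IH] i j; first by rewrite expn0 !ltnS !leqn0 => /eqP -> /eqP ->.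
rewrite expnS mul2n => ilt jlt eqb.
rewrite -(odd_double_half i) -(odd_double_half j).
have -> : odd i = odd j by have := eqb 0%N isT; rewrite !bit0.
rewrite (IH i./2 j./2) ?ltn_half_double// => k km.
by rewrite -!bitS; apply: eqb.
Qed.

Lemma bit_inj (m : nat) (i j : 'I_(2 ^ m)) :
  (forall k : 'I_m, bit i k = bit j k) -> i = j.
Proof.
by move=> eqb; apply/val_inj/(bit_ext (ltn_ord i) (ltn_ord j)) => k km; exact: (eqb (Ordinal km)).
Qed.

Lemma bit0n (k : nat) : bit 0 k = false.
Proof. by rewrite /bit div0n. Qed.

Lemma bit_exp2 (k l : nat) : bit (2 ^ k) l = (l == k).
Proof.
elim: k l => [|k IH] [|l]; first by rewrite bit0.
- by rewrite bitS /= bit0n.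
- by rewrite bit0 expnS mul2n odd_double.
- by rewrite bitS expnS mul2n doubleK IH.
Qed.

(** * Expectations over independent bits, main effects, Hadamard transform *)

Section BitExpectation.
Variables (R : realType) (m : nat).

(** Distributing the product gives a sum over all maps from bits to booleans; binary expansion is a
    bijection onto these maps, being injective between sets of size [2 ^ m]. *)
Lemma sum_prod_bits (F : 'I_m -> bool -> R) :
  \sum_(i < 2 ^ m) \prod_(k < m) F k (bit i k) = \prod_(k < m) \sum_(u : bool) F k u.
Proof.
rewrite bigA_distr_bigA.
pose b (i : 'I_(2 ^ m)) : {ffun 'I_m -> bool} := [ffun k : 'I_m => bit i k].
have b_inj : injective b.
  by move=> i j /ffunP eqb; apply: bit_inj => k; have := eqb k; rewrite !ffunE.
have b_bij : bijective b.
  by apply: inj_card_bij => //; rewrite card_ffun card_bool !card_ord.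
rewrite (reindex b) /=; last exact: onW_bij.
by apply: eq_bigr => i _; apply: eq_bigr => k _; rewrite ffunE.
Qed.

Lemma hadh_sym (i j : nat) : hadh R m i j = hadh R m j i.
Proof. by rewrite /hadh; apply: eq_bigr => k _; rewrite andbC. Qed.

Lemma hadh0 (i : nat) : hadh R m 0 i = 1.
Proof. by rewrite /hadh big1 // => k _; rewrite bit0n. Qed.

Lemma hadh_exp2 (k : 'I_m) (i : nat) : hadh R m (2 ^ k) i = (-1) ^+ bit i k.
Proof.
rewrite /hadh (bigD1 k) //= bit_exp2 eqxx /= big1 ?mulr1 // => l lk.
by rewrite bit_exp2 -val_eqE /= in lk *; rewrite (negbTE lk).
Qed.

(** The product of two characters factors over the bits; at a bit where the indices differ, the
    factor is 1 + (-1) = 0. *)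
Lemma hadh_orthogonal (j l : 'I_(2 ^ m)) :
  \sum_(i < 2 ^ m) hadh R m j i * hadh R m l i = (2 ^ m)%:R * (j == l)%:R.
Proof.
under eq_bigr do rewrite /hadh -big_split /=.
rewrite (sum_prod_bits
  (fun k u => (-1) ^+ (bit j k && u) * (-1) ^+ (bit l k && u))).
case: eqP => [->|/eqP jl].
  rewrite mulr1 natrX (eq_bigr (fun=> 2)) => [|k _].
    by rewrite prodr_const card_ord.
  by rewrite big_bool /= andbT andbF -expr2 sqrr_sign mulr1 -[2]/(1 + 1).
rewrite mulr0.
have [k jk] : exists k : 'I_m, bit j k != bit l k.
  apply: contrapT => /forallNP eqb; case/negP: jl; apply/eqP/bit_inj => k.
  by have /negP := eqb k; rewrite negbK => /eqP.
rewrite (bigD1 k) //= big_bool /= !andbT !andbF.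
by move: jk; case: (bit j k); case: (bit l k) => //= _;
  rewrite ?expr1 ?expr0 ?(mulr1, mul1r) addNr mul0r.
Qed.

Lemma hadh_inversion (x : 'I_(2 ^ m) -> R) (i : 'I_(2 ^ m)) :
  x i = \sum_(j < 2 ^ m) hadh R m j i *
        ((2 ^ m)%:R^-1 * \sum_(l < 2 ^ m) hadh R m j l * x l).
Proof.
have M0 : (2 ^ m)%:R != 0 :> R by rewrite pnatr_eq0 expn_eq0.
have -> : \sum_(j < 2 ^ m) hadh R m j i *
    ((2 ^ m)%:R^-1 * \sum_(l < 2 ^ m) hadh R m j l * x l) =
    \sum_(l < 2 ^ m) (2 ^ m)%:R^-1 * x l *
      \sum_(j < 2 ^ m) hadh R m i j * hadh R m l j.
  under eq_bigr do rewrite !mulr_sumr; rewrite exchange_big /=.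
  apply: eq_bigr => l _; rewrite mulr_sumr; apply: eq_bigr => j _.
  by rewrite (hadh_sym i) (hadh_sym l); ring.
rewrite (bigD1 i) //= hadh_orthogonal eqxx big1 => [|l li].
  by rewrite addr0 mulr1 mulrAC mulVf ?mul1r.
by rewrite hadh_orthogonal eq_sym (negbTE li) !mulr0.
Qed.

Variables (p : 'I_m -> R).
Hypothesis p01 : forall k, 0 < p k < 1.

Lemma PC_gt0 (k : 'I_m) (u : bool) : 0 < PC p k u.
Proof. by case/andP: (p01 k) => p0 p1; case: u; rewrite /PC ?subr_gt0. Qed.

Lemma PC_sum (k : 'I_m) : \sum_(u : bool) PC p k u = 1.
Proof. by rewrite big_bool /= subrK. Qed.

Lemma Psym_gt0 (i : nat) : 0 < Psym p i.
Proof. by rewrite /Psym prodr_gt0 // => k _; exact: PC_gt0. Qed.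

Lemma mean_prod_bits (F : 'I_m -> bool -> R) :
  \sum_(i < 2 ^ m) Psym p i * \prod_(k < m) F k (bit i k) =
  \prod_(k < m) \sum_(u : bool) PC p k u * F k u.
Proof.
under eq_bigr do rewrite /Psym -big_split /=.
exact: (sum_prod_bits (fun k u => PC p k u * F k u)).
Qed.

Lemma Psym_sum : \sum_(i < 2 ^ m) Psym p i = 1.
Proof.
have := mean_prod_bits (fun _ _ => 1).
under eq_bigr do rewrite big1_eq mulr1.
move=> ->; rewrite big1 // => k _; under eq_bigr do rewrite mulr1.
exact: PC_sum.
Qed.

(** Independence of two bits, obtained from [mean_prod_bits] with all other factors equal to 1. *)
Lemma mean_bit2 (k l : 'I_m) (f g : bool -> R) : k != l ->
  \sum_(i < 2 ^ m) Psym p i * (f (bit i k) * g (bit i l)) =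
  (\sum_(u : bool) PC p k u * f u) * (\sum_(u : bool) PC p l u * g u).
Proof.
move=> kl.
pose F (r : 'I_m) u : R := if r == k then f u else if r == l then g u else 1.
(* Stated for any [G] sending the constant 1 to 1, so that it evaluates both the product of the
   values and the product of the expectations. *)
have prodF (G : 'I_m -> (bool -> R) -> R) : (forall r, G r (fun=> 1) = 1) ->
    \prod_r G r (F r) = G k f * G l g.
  move=> G1; rewrite (bigD1 k) //= (bigD1 l) /=; last by rewrite eq_sym.
  rewrite big1 => [|r /andP[rk rl]].
    by rewrite mulr1 /F eqxx eq_sym (negbTE kl) eqxx.
  by rewrite -[RHS](G1 r); congr G; apply/funext => u; rewrite /F (negbTE rk) (negbTE rl).
have := mean_prod_bits F.
rewrite (prodF (fun r f => \sum_(u : bool) PC p r u * f u)) => [<-|r].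
  apply: eq_bigr => i _; congr (_ * _).
  by rewrite (prodF (fun r f => f (bit i r))).
by under eq_bigr do rewrite mulr1; exact: PC_sum.
Qed.

Lemma mean_bit (k : 'I_m) (f : bool -> R) :
  \sum_(i < 2 ^ m) Psym p i * f (bit i k) = \sum_(u : bool) PC p k u * f u.
Proof.
pose F (r : 'I_m) u : R := if r == k then f u else 1.
have prodF (G : 'I_m -> (bool -> R) -> R) : (forall r, G r (fun=> 1) = 1) ->
    \prod_r G r (F r) = G k f.
  move=> G1; rewrite (bigD1 k) //= big1 => [|r rk]; first by rewrite mulr1 /F eqxx.
  by rewrite -[RHS](G1 r); congr G; apply/funext => u; rewrite /F (negbTE rk).
have := mean_prod_bits F.
rewrite (prodF (fun r f => \sum_(u : bool) PC p r u * f u)) => [<-|r].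
  by apply: eq_bigr => i _; congr (_ * _); rewrite (prodF (fun r f => f (bit i r))).
by under eq_bigr do rewrite mulr1; exact: PC_sum.
Qed.

(* [condw k u i] is the weight P(X = x_i | C_k = u), and [dev k u i] its excess
   over P(X = x_i). *)
Definition condw (k : 'I_m) (u : bool) (i : nat) : R :=
  if bit i k == u then Psym p i / PC p k u else 0.

Definition dev (k : 'I_m) (u : bool) (i : nat) : R := condw k u i - Psym p i.

Definition mean (x : 'I_(2 ^ m) -> R) : R := \sum_(i < 2 ^ m) Psym p i * x i.

(** The main effect of bit [k]: E[x | C_k = u] - E[x]. *)
Definition cdev (x : 'I_(2 ^ m) -> R) (k : 'I_m) (u : bool) : R :=
  \sum_(i < 2 ^ m) dev k u i * x i.

Lemma condw_sum (k : 'I_m) (u : bool) : \sum_(i < 2 ^ m) condw k u i = 1.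
Proof.
have PC0 := lt0r_neq0 (PC_gt0 k u).
have := mean_bit k (fun v => (v == u)%:R / PC p k u).
have -> : \sum_v PC p k v * ((v == u)%:R / PC p k u) = 1.
  by rewrite (bigD1 u) //= eqxx mul1r divff // big1 ?addr0 // => v /negbTE ->; rewrite mul0r mulr0.
move=> <-; apply: eq_bigr => i _; rewrite /condw.
by case: eqP => _; rewrite ?mul1r ?mul0r ?mulr0.
Qed.

(** Tower property: conditioning on bit [k], where [cdev x k u + mean x] is the conditional mean
    E[x | C_k = u]. *)
Lemma mean_bit_mul (x : 'I_(2 ^ m) -> R) (k : 'I_m) (g : bool -> R) :
  mean (fun i => x i * g (bit i k)) =
  \sum_(u : bool) PC p k u * g u * (cdev x k u + mean x).
Proof.
have cE u : cdev x k u + mean x = \sum_(i < 2 ^ m) condw k u i * x i.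
  by rewrite /cdev /mean -big_split /=; apply: eq_bigr => i _; rewrite /dev; ring.
under eq_bigr do rewrite cE mulr_sumr.
rewrite exchange_big /=; apply: eq_bigr => i _.
rewrite (bigD1 (bit i k)) //= big1 => [|u ui].
  by rewrite /condw eqxx addr0; field; rewrite gt_eqF // PC_gt0.
by rewrite /condw eq_sym (negbTE ui) mul0r mulr0.
Qed.

Lemma cdev_mean0 (x : 'I_(2 ^ m) -> R) (k : 'I_m) :
  \sum_(u : bool) PC p k u * cdev x k u = 0.
Proof.
have := mean_bit_mul x k (fun=> 1).
under [RHS]eq_bigr do rewrite mulr1 mulrDr.
rewrite big_split /= -mulr_suml PC_sum mul1r.
have -> : mean (fun i => x i * 1) = mean x by apply: eq_bigr => i _; rewrite mulr1.
by move=> /eqP; rewrite eq_sym -subr_eq0 addrK => /eqP.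
Qed.

Lemma meanD (x y : 'I_(2 ^ m) -> R) : mean (fun i => x i + y i) = mean x + mean y.
Proof. by rewrite /mean -big_split /=; apply: eq_bigr => i _; rewrite mulrDr. Qed.

Lemma meanZ (c : R) (x : 'I_(2 ^ m) -> R) : mean (fun i => c * x i) = c * mean x.
Proof. by rewrite /mean mulr_sumr; apply: eq_bigr => i _; rewrite mulrCA. Qed.

Lemma mean_cst (c : R) : mean (fun=> c) = c.
Proof. by rewrite /mean -mulr_suml Psym_sum mul1r. Qed.

Lemma mean_sum (I : finType) (x : I -> 'I_(2 ^ m) -> R) :
  mean (fun i => \sum_k x k i) = \sum_k mean (x k).
Proof.
rewrite /mean exchange_big /=; apply: eq_bigr => i _; by rewrite mulr_sumr.
Qed.

(** The cross terms vanish, because distinct bits are independent and each [g k] is centred. *)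
Lemma mean_sqr_additive (g : 'I_m -> bool -> R) :
  (forall k, \sum_(u : bool) PC p k u * g k u = 0) ->
  mean (fun i => (\sum_(k < m) g k (bit i k)) ^+ 2) =
  \sum_(k < m) \sum_(u : bool) PC p k u * g k u ^+ 2.
Proof.
move=> g0.
have -> : mean (fun i => (\sum_(k < m) g k (bit i k)) ^+ 2) =
    mean (fun i => \sum_(k < m) \sum_(l < m) g k (bit i k) * g l (bit i l)).
  apply: eq_bigr => i _; congr (_ * _); rewrite expr2 mulr_suml.
  by apply: eq_bigr => k _; rewrite mulr_sumr.
rewrite mean_sum; apply: eq_bigr => k _; rewrite mean_sum (bigD1 k) //=.
rewrite [X in _ + X]big1 => [|l lk]; last first.
  by rewrite /mean mean_bit2 1?eq_sym // g0 mul0r.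
by rewrite addr0 -(mean_bit k (fun u => g k u ^+ 2)).
Qed.

(* Orthogonal decomposition of x into its mean, its main effects (the centred
   conditional means given one bit) and the interactions. *)
Lemma main_effects_decomposition (x : 'I_(2 ^ m) -> R) :
  mean (fun i => x i ^+ 2) =
  mean x ^+ 2 + \sum_(k < m) \sum_(u : bool) PC p k u * cdev x k u ^+ 2 +
  mean (fun i => (x i - mean x - \sum_(k < m) cdev x k (bit i k)) ^+ 2).
Proof.
pose f (i : 'I_(2 ^ m)) := \sum_(k < m) cdev x k (bit i k).
set V := \sum_(k < m) \sum_(u : bool) _.
have f0 : mean f = 0.
  by rewrite mean_sum big1 // => k _; rewrite /mean mean_bit cdev_mean0.
have ff : mean (fun i => f i ^+ 2) = V by apply: mean_sqr_additive => k; exact: cdev_mean0.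
(* By the tower property x correlates with its main effects exactly as they do with themselves, so
   the residual is orthogonal to them. *)
have xf : mean (fun i => x i * f i) = V.
  have -> : mean (fun i => x i * f i) =
      mean (fun i => \sum_(k < m) x i * cdev x k (bit i k)).
    by apply: eq_bigr => i _; rewrite mulr_sumr.
  rewrite mean_sum; apply: eq_bigr => k _; rewrite mean_bit_mul.
  under eq_bigr do rewrite mulrDr.
  rewrite big_split /= -mulr_suml cdev_mean0 mul0r addr0.
  by apply: eq_bigr => u _; rewrite expr2 mulrA.
have -> : mean (fun i => (x i - mean x - f i) ^+ 2) =
    mean (fun i => x i ^+ 2 + (mean x ^+ 2 + (f i ^+ 2 + (- 2 * mean x * x i +
      (- 2 * (x i * f i) + 2 * mean x * f i))))).
  by apply: eq_bigr => i _; congr (_ * _); ring.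
by rewrite !meanD !meanZ mean_cst ff xf f0; ring.
Qed.

(** Centring the [g k] rules out a mean: x consists of main effects only. *)
Definition additive (x : 'I_(2 ^ m) -> R) : Prop :=
  exists2 g : 'I_m -> bool -> R,
    (forall k, \sum_(u : bool) PC p k u * g k u = 0) &
    (forall i, x i = \sum_(k < m) g k (bit i k)).

(** In [main_effects_decomposition] the squared mean and the interaction energy are nonnegative, so
    equality holds exactly when both vanish. *)
Lemma additiveP (x : 'I_(2 ^ m) -> R) : additive x <->
  mean (fun i => x i ^+ 2) = \sum_(k < m) \sum_(u : bool) PC p k u * cdev x k u ^+ 2.
Proof.
split=> [[g g0 xg]|E].
  have mx : mean x = 0.
    rewrite (_ : x = fun i : 'I_(2 ^ m) => \sum_(k < m) g k (bit i k)); last exact/funext.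
    by rewrite mean_sum big1 // => k _; rewrite /mean mean_bit g0.
  (* Testing x against the indicator of C_k = u recovers [g k u], as the other bits contribute zero
     by independence. *)
  have ceq k u : cdev x k u = g k u.
    have := mean_bit_mul x k (fun v => (v == u)%:R).
    rewrite (bigD1 u) //= big1 => [|v /negbTE ->]; last by rewrite mulr0 mul0r.
    rewrite eqxx mulr1 mx !addr0 => E; apply: (mulfI (lt0r_neq0 (PC_gt0 k u))).
    rewrite -{}E.
    have -> : mean (fun i => x i * (bit i k == u)%:R) =
        mean (fun i => \sum_(l < m) g l (bit i l) * (bit i k == u)%:R).
      by apply: eq_bigr => i _; rewrite xg mulr_suml.
    rewrite mean_sum (bigD1 k) //= [X in _ + X]big1 => [|l lk]; last first.
      by rewrite /mean (mean_bit2 _ (fun v => (v == u)%:R) lk) g0 mul0r.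
    rewrite addr0 /mean (mean_bit k (fun v => g k v * (v == u)%:R)).
    rewrite (bigD1 u) //= big1 => [|v /negbTE ->]; last by rewrite !mulr0.
    by rewrite eqxx mulr1 addr0.
  rewrite main_effects_decomposition mx expr0n add0r.
  rewrite [X in _ + X](_ : _ = 0) ?addr0 //; rewrite /mean big1 // => i _.
  rewrite xg subr0; under [X in _ - X]eq_bigr do rewrite ceq.
  by rewrite subrr expr0n mulr0.
have := main_effects_decomposition x; rewrite E => /eqP.
rewrite addrAC -subr_eq subrr eq_sym paddr_eq0 ?sqr_ge0 //; last first.
  by apply: sumr_ge0 => i _; rewrite mulr_ge0 ?sqr_ge0 // ltW // Psym_gt0.
rewrite sqrf_eq0 => /andP[/eqP mx].
rewrite psumr_eq0 => [/allP rest|i _]; last first.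
  by rewrite mulr_ge0 ?sqr_ge0 // ltW // Psym_gt0.
exists (cdev x) => [k|i]; first exact: cdev_mean0.
have := rest i (mem_index_enum _).
by rewrite mulf_eq0 gt_eqF ?Psym_gt0 //= sqrf_eq0 mx subr0 subr_eq0 => /eqP.
Qed.

Definition had (x : 'I_(2 ^ m) -> R) (j : nat) : R :=
  (2 ^ m)%:R^-1 * \sum_(i < 2 ^ m) hadh R m j i * x i.

Lemma exp2_ord (k : 'I_m) : (2 ^ k < 2 ^ m)%N.
Proof. by rewrite ltn_exp2l. Qed.

(** A centred function of one bit is a multiple of [(PC p k true - PC p k false) + (-1) ^+ u], whose
    transform lives on the indices 0 and [2 ^ k], with values [PC p k true - PC p k false] and 1.
    Conversely, Hadamard inversion rebuilds a sum of such functions. *)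
Lemma additive_hadP (x : 'I_(2 ^ m) -> R) : additive x <->
  had x 0 = \sum_(k < m) (PC p k true - PC p k false) * had x (2 ^ k) /\
  forall j, (j < 2 ^ m)%N -> j != 0%N -> (forall k : 'I_m, j != 2 ^ k)%N ->
    had x j = 0.
Proof.
have M0 : (2 ^ m)%:R != 0 :> R by rewrite pnatr_eq0 expn_eq0.
have gt0 : (0 < 2 ^ m)%N by rewrite expn_gt0.
split=> [[g g0 xg]|[x0 xj]].
  (* The coefficient of the character [(-1) ^+ u] in [g k]. *)
  pose b k : R := (g k false - g k true) / 2.
  have gE k u : g k u = b k * ((PC p k true - PC p k false) + (-1) ^+ u).
    have := g0 k; rewrite big_bool /= /PC /b => E.
    have {}E : p k * (g k false - g k true) = - g k true.
      by move: E => /eqP; rewrite addrC addr_eq0 => /eqP E; rewrite mulrBr E; ring.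
    have -> : forall z, (g k false - g k true) / 2 * (1 - p k - p k + z) =
      (g k false - g k true) * (1 + z) / 2 - p k * (g k false - g k true).
      by move=> z; field.
    by rewrite E; case: u; rewrite ?expr1 ?expr0; field.
  have hadE j : (j < 2 ^ m)%N -> had x j =
      \sum_(k < m) b k * ((PC p k true - PC p k false) * (j == 0%N)%:R + (j == 2 ^ k)%N%:R).
    move=> jm; rewrite /had.
    under eq_bigr do rewrite xg mulr_sumr.
    rewrite exchange_big mulr_sumr /=; apply: eq_bigr => k _.
    under eq_bigr => i _ do rewrite gE mulrCA mulrDr.
    rewrite -mulr_sumr big_split /= mulrCA; congr (_ * _).
    have /= := hadh_orthogonal (Ordinal jm) (Ordinal gt0).
    under eq_bigr do rewrite hadh0 mulr1.
    have /= := hadh_orthogonal (Ordinal jm) (Ordinal (exp2_ord k)).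
    under eq_bigr do rewrite hadh_exp2.
    rewrite -!val_eqE /= => -> E.
    by rewrite -mulr_suml E; field.
  split=> [|j jm j0 jk].
    rewrite hadE //; apply: eq_bigr => k _.
    have -> : had x (2 ^ k) = b k.
      rewrite hadE ?exp2_ord // (bigD1 k) //= eqxx expn_eq0 /= big1 => [|l lk].
        by rewrite mulr0 add0r mulr1 addr0.
      rewrite eqn_exp2l // eq_sym (inj_eq val_inj) (negbTE lk).
      by rewrite mulr0 addr0 mulr0.
    by rewrite eqxx eq_sym expn_eq0 /= mulr1 addr0 mulrC.
  rewrite hadE // big1 // => k _.
  by rewrite (negbTE j0) (negbTE (jk k)) mulr0 addr0 mulr0.
exists (fun (k : 'I_m) u => had x (2 ^ k) * ((PC p k true - PC p k false) + (-1) ^+ u)) => [k|i].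
  by rewrite big_bool /PC /= expr1 expr0; ring.
rewrite {1}(hadh_inversion x i).
pose e (k : 'I_m) : 'I_(2 ^ m) := Ordinal (exp2_ord k).
have e_inj : injective e.
  by move=> k l /(congr1 val) /= /eqP; rewrite eqn_exp2l // => /eqP/val_inj.
(* Split the inversion formula into powers of two and other indices; of the latter only 0 survives,
   and [x0] spreads it over the bits. *)
rewrite (bigID (fun j : 'I_(2 ^ m) => j \in codom e)) /=.
rewrite (bigD1 (Ordinal gt0) (P := fun j => j \notin codom e)) /=; last first.
  apply/negP => /codomP[k /(congr1 val) /= /esym/eqP].
  by rewrite expn_eq0.
rewrite [X in _ + (_ + X)]big1 => [|j /andP[je j0]]; last first.
  rewrite -/(had x j) xj ?mulr0 // => k; apply: contra je => /eqP jk.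
  by apply/codomP; exists k; apply: val_inj.
rewrite -/(had x 0) hadh0 mul1r addr0 x0.
rewrite -big_uniq /=; last by rewrite map_inj_uniq ?enum_uniq.
rewrite /codom /image_mem big_map big_enum /= -big_split /=; apply: eq_bigr => k _.
by rewrite -/(had x (2 ^ k)) hadh_exp2; ring.
Qed.

End BitExpectation.

(** * Splitting of the symbol energy *)

Section Energy.
Variables (R : realType) (m N : nat) (X : 'M[R]_(2 ^ m, N)) (p : 'I_m -> R).
Hypothesis p01 : forall k, 0 < p k < 1.

(** The sum over the bits of Var(E[X | C_k]). *)
Definition Vmain : R :=
  \sum_(n < N) \sum_(k < m) \sum_(u : bool) PC p k u * cdev p (X ^~ n) k u ^+ 2.

Lemma EsE : Es X p = \sum_(n < N) mean p (fun i => X i n ^+ 2).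
Proof.
rewrite /Es /mean exchange_big /=; apply: eq_bigr => i _.
by rewrite mulr_sumr.
Qed.

Lemma hadamardE (j : nat) (n : 'I_N) : hadamard X j 0 n = had (X ^~ n) j.
Proof.
rewrite /hadamard /had !mxE summxE; congr (_ * _).
by apply: eq_bigr => i _; rewrite !mxE.
Qed.

(** In each coordinate the main effects carry at most the energy, so equality of the totals forces
    equality, hence additivity, in every coordinate. *)
Lemma Vmain_EsP : Vmain = Es X p <->
  (hadamard X 0 = \sum_(k < m) (PC p k true - PC p k false) *: hadamard X (2 ^ k)
   /\ forall j, (j < 2 ^ m)%N -> j != 0%N -> (forall k : 'I_m, j != 2 ^ k)%N ->
        hadamard X j = 0).
Proof.
transitivity (forall n : 'I_N, additive p (X ^~ n)).
  rewrite EsE /Vmain; split=> [E n|ad]; last first.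
    by apply: eq_bigr => n _; apply/esym/(additiveP p01)/ad.
  apply/(additiveP p01)/eqP; rewrite -subr_eq0; apply/eqP.
  have : \sum_(n < N) (mean p (fun i => X i n ^+ 2) -
      \sum_(k < m) \sum_(u : bool) PC p k u * cdev p (X ^~ n) k u ^+ 2) == 0.
    by rewrite sumrB E subrr.
  rewrite psumr_eq0 => [/allP h|l _]; first by apply/eqP/h/mem_index_enum.
  rewrite subr_ge0 (main_effects_decomposition p01) addrAC lerDr.
  rewrite addr_ge0 ?sqr_ge0 //; apply: sumr_ge0 => i _.
  by rewrite mulr_ge0 ?sqr_ge0 // ltW // Psym_gt0.
split=> [ad|[h0 hj] n].
  split=> [|j jm j0 jk]; apply/rowP => n.
    rewrite summxE hadamardE; have /additive_hadP[-> _] := ad n.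
    by apply: eq_bigr => k _; rewrite mxE hadamardE.
  by rewrite hadamardE mxE; have /additive_hadP[_] := ad n; apply.
apply/additive_hadP; split=> [|j jm j0 jk].
  rewrite -hadamardE h0 summxE; apply: eq_bigr => k _.
  by rewrite mxE hadamardE.
by rewrite -hadamardE hj // mxE.
Qed.

End Energy.

(** * Comparison of integrals *)

Section IntegralMonotone.
Context (d : measure_display) (T : measurableType d) (R : realType)
        (mu : {measure set T -> \bar R}).

(* No measurability is assumed: the integral of a nonnegative function is the
   supremum of the integrals of the simple functions below it. *)
Lemma integral_mono (f g : T -> \bar R) :
  (forall x, (f x <= g x)%E) -> (\int[mu]_x f x <= \int[mu]_x g x)%E.
Proof.
move=> fg; rewrite integralE [leRHS]integralE.
have mono (f' g' : T -> \bar R) : (forall x, (0 <= f' x)%E) ->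
    (forall x, (f' x <= g' x)%E) -> (\int[mu]_x f' x <= \int[mu]_x g' x)%E.
  move=> f'0 fg'; rewrite !ge0_integralTE // => [|x]; last exact: le_trans (fg' x).
  apply: le_ereal_sup => _ [h hf <-]; exists h => // x.
  exact: le_trans (hf x) (fg' x).
apply: leeB; apply: mono => x //.
  by apply: (@funepos_le _ _ setT); rewrite ?inE // => y _; exact: fg.
by apply: (@funeneg_le _ _ setT); rewrite ?inE // => y _; exact: fg.
Qed.

(** The integrable bounds make the middle integral finite, so that [fine] preserves the order. *)
Lemma Rintegral_between (lo f hi : T -> R) :
  mu.-integrable setT (EFin \o lo) -> mu.-integrable setT (EFin \o hi) ->
  (forall x, lo x <= f x <= hi x) ->
  Rintegral mu setT lo <= Rintegral mu setT f <= Rintegral mu setT hi.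
Proof.
move=> ilo ihi lofhi.
have fl := integrable_fin_num measurableT ilo.
have fh := integrable_fin_num measurableT ihi.
have lof : (\int[mu]_x (lo x)%:E <= \int[mu]_x (f x)%:E)%E.
  by apply: integral_mono => x; rewrite lee_fin; case/andP: (lofhi x).
have fhi : (\int[mu]_x (f x)%:E <= \int[mu]_x (hi x)%:E)%E.
  by apply: integral_mono => x; rewrite lee_fin; case/andP: (lofhi x).
have ff : (\int[mu]_x (f x)%:E)%E \is a fin_num.
  rewrite fin_numElt; apply/andP; split.
    by apply: lt_le_trans lof; rewrite ltNye_eq fl.
  by apply: le_lt_trans fhi _; rewrite ltey_eq fh.
by rewrite /Rintegral !fine_le.
Qed.

End IntegralMonotone.

(** * Iterated Lebesgue integrals and the Gaussian density *)

Section IteratedIntegral.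
Variable R : realType.
Notation mu := (@lebesgue_measure R).
Implicit Types (F : (nat -> R) -> R) (v : R).

(* [iintegral n F v]: all the integrals of [iint n F] are genuine, and the
   result is [v]. *)
Fixpoint iintegral (n : nat) F v : Prop :=
  match n with
  | 0 => F (fun _ => 0) = v
  | n'.+1 => exists G : R -> R,
      [/\ forall t, iintegral n' (fun y => F (upd y n' t)) (G t),
          mu.-integrable setT (EFin \o G) & Rintegral mu setT G = v]
  end.

Lemma iintegralD n F1 v1 F2 v2 : iintegral n F1 v1 -> iintegral n F2 v2 ->
  iintegral n (fun y => F1 y + F2 y) (v1 + v2).
Proof.
elim: n F1 v1 F2 v2 => [|n IH] F1 v1 F2 v2 /=; first by move=> -> ->.
move=> [G1 [h1 i1 <-]] [G2 [h2 i2 <-]]; exists (fun t => G1 t + G2 t); split.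
- by move=> t; exact: IH.
- exact: (integrableD measurableT i1 i2).
- exact: RintegralD.
Qed.

Lemma iintegralZ n (c : R) F v :
  iintegral n F v -> iintegral n (fun y => c * F y) (c * v).
Proof.
elim: n F v => [|n IH] F v /=; first by move=> ->.
move=> [G [h i <-]]; exists (fun t => c * G t); split.
- by move=> t; exact: IH.
- exact: (integrableZl measurableT c i).
- exact: RintegralZl.
Qed.

(** Comparison at every level of the iteration: an integrand without closed-form integral, such as a
    ln(a/b), is controlled by bounds whose integrals are explicit. *)
Lemma iintegral_between n lo F hi vl vh :
  iintegral n lo vl -> iintegral n hi vh -> (forall y, lo y <= F y <= hi y) ->
  vl <= iint n F <= vh.
Proof.
elim: n lo F hi vl vh => [|n IH] lo F hi vl vh /=; first by move=> <- <-.
move=> [Gl [hl il <-]] [Gh [hh ih <-]] between.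
by apply: Rintegral_between => // t; exact: IH (hl t) (hh t) _.
Qed.

Lemma iintegral_prod n (g : nat -> R -> R) :
  (forall j, (j < n)%N -> mu.-integrable setT (EFin \o g j)) ->
  (forall j, (j < n)%N -> Rintegral mu setT (g j) = 1) ->
  iintegral n (fun y => \prod_(j < n) g j (y j)) 1.
Proof.
elim: n => [|n IH] ig Ig /=; first by rewrite big_ord0.
exists (fun t => g n t * 1); split.
- move=> t; rewrite (_ : (fun y => _) = fun y : nat -> R => g n t * \prod_(j < n) g j (y j)).
    by apply: iintegralZ; apply: IH => j jn; [apply: ig|apply: Ig]; exact: ltnW.
  apply/funext => y; rewrite big_ord_recr /= mulrC {1}/upd eqxx; congr (_ * _).
  by apply: eq_bigr => j _; rewrite /upd ltn_eqF.
- rewrite (_ : (fun t => _) = g n); first exact: ig.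
  by apply/funext => t; rewrite mulr1.
- by under eq_Rintegral do rewrite mulr1; exact: Ig.
Qed.

Variable N : nat.
Implicit Types (f : 'rV[R]_N -> R).

Definition hasint f v : Prop := iintegral N (fun y => f (\row_(n < N) y n)) v.

Lemma hasintD f1 v1 f2 v2 : hasint f1 v1 -> hasint f2 v2 ->
  hasint (fun y => f1 y + f2 y) (v1 + v2).
Proof. exact: iintegralD. Qed.

Lemma hasintZ (c : R) f v : hasint f v -> hasint (fun y => c * f y) (c * v).
Proof. exact: iintegralZ. Qed.

(** The factor [c] will be [ln 2], converting an integrand in bits into nats. *)
Lemma hasint_between (c : R) lo f hi vl vh : 0 < c ->
  hasint lo vl -> hasint hi vh -> (forall y, lo y <= c * f y <= hi y) ->
  vl <= c * intRN f <= vh.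
Proof.
move=> c0 hl hh between; rewrite -ler_pdivrMl // -(ler_pdivlMl _ vh c0).
have := hasintZ c^-1 hl; have := hasintZ c^-1 hh.
rewrite /hasint => ih il; apply: (iintegral_between il ih) => y.
by rewrite ler_pdivrMl // ler_pdivlMl.
Qed.

Lemma hasint_ext f g v : f =1 g -> hasint f v -> hasint g v.
Proof. by move=> /funext ->. Qed.

Lemma normal_pdf_sqrt (b N0 t : R) : 0 < N0 ->
  normal_pdf b (Num.sqrt (N0 / 2)) t =
  (Num.sqrt (pi * N0))^-1 * expR (- (t - b) ^+ 2 / N0).
Proof.
move=> N00; have s0 : Num.sqrt (N0 / 2) != 0 by rewrite gt_eqF // sqrtr_gt0 divr_gt0.
rewrite normal_pdfE // /normal_peak /normal_fun sqr_sqrtr ?divr_ge0 ?ltW //.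
have -> : N0 / 2 * pi *+ 2 = pi * N0 by rewrite -mulr_natr; field.
by have -> : N0 / 2 *+ 2 = N0 by rewrite -mulr_natr; field.
Qed.

Lemma hasint_gauss (N0 : R) (b : 'rV[R]_N) : 0 < N0 ->
  hasint (fun y => gauss N0 (y - b)) 1.
Proof.
move=> N00; rewrite /hasint.
(* [c] extends [b] to all indices; its default value 0 is never reached below [N]. *)
pose c (j : nat) : R := if insub j is Some k then b 0 k else 0.
pose g (j : nat) : R -> R := normal_pdf (c j) (Num.sqrt (N0 / 2)).
rewrite (_ : (fun y => _) = fun y : nat -> R => \prod_(j < N) g j (y j)); last first.
  apply/funext => y; apply: eq_bigr => j _.
  by rewrite !mxE /g normal_pdf_sqrt // /c valK.
apply: iintegral_prod => j _; first exact: integrable_normal_pdf.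
by rewrite /Rintegral integral_normal_pdf.
Qed.

Lemma hasint0 : hasint (fun=> 0) 0.
Proof.
have := hasintZ 0 (hasint_gauss 0 (@ltr01 R)); rewrite mul0r.
by apply: hasint_ext => y; rewrite mul0r.
Qed.

Lemma hasint_sum (I : finType) (f : I -> 'rV[R]_N -> R) (v : I -> R) :
  (forall i, hasint (f i) (v i)) -> hasint (fun y => \sum_i f i y) (\sum_i v i).
Proof.
move=> hf; elim: (index_enum I) => [|i s IH].
  by rewrite big_nil; apply: hasint_ext hasint0 => y; rewrite big_nil.
rewrite big_cons; apply: hasint_ext (hasintD (hf i) IH) => y.
by rewrite big_cons.
Qed.

End IteratedIntegral.

(** * Taylor bounds for r ln r, exp and a ln(a/b) *)

Section LogTaylor.
Variable R : realType.
Implicit Types a b c r x : R.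

Lemma ln_le_sub1 x : 0 < x -> ln x <= x - 1.
Proof. by move=> x0; rewrite -{1}(subrKC 1 x) le_ln1Dx // ltrBrDl subrr. Qed.

Lemma ln_ge_1subV x : 0 < x -> 1 - x^-1 <= ln x.
Proof.
move=> x0; have := @ln_le_sub1 x^-1; rewrite invr_gt0 => /(_ x0).
by rewrite lnV // => ?; lra.
Qed.

(** [psi 0] is the second-order Taylor remainder of r ln r at 1; the cubic term serves to fix the
    sign of the derivative [dpsi]. *)
Let psi (k r : R) := r * ln r - (r - 1) - (r - 1) ^+ 2 / 2 + k * (r - 1) ^+ 3.
Let dpsi (k r : R) := ln r - (r - 1) + 3 * k * (r - 1) ^+ 2.

Let psi_derive k r : 0 < r -> is_derive r 1 (psi k) (dpsi k r).
Proof.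
move=> r0; rewrite /psi.
have dln := is_derive1_ln r0.
apply: is_derive_eq.
rewrite /dpsi /GRing.scale /=; field; exact: lt0r_neq0.
Qed.

Let psi_MVT k a b : 0 < a -> a < b ->
  exists2 c, a < c < b & psi k b - psi k a = dpsi k c * (b - a).
Proof.
move=> a0 ab.
have der x : a <= x -> is_derive x 1 (psi k) (dpsi k x).
  by move=> ax; apply: psi_derive; exact: lt_le_trans ax.
have [||c] := @MVT _ (psi k) (dpsi k) a b ab.
- by move=> x; rewrite in_itv /= => /andP[/ltW ax _]; exact: der.
- apply: derivable_within_continuous => x; rewrite in_itv /= => /andP[ax _].
  by have := der _ ax => -[].
- by rewrite in_itv /=; exists c.
Qed.

(** [dpsi 0] is nonpositive everywhere and [dpsi 8] nonnegative from 1/2 on, so the mean value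
    theorem bounds the remainder from both sides. *)
Lemma xlnx_taylor r : 0 < r ->
  `|r * ln r - (r - 1) - (r - 1) ^+ 2 / 2| <= 8 * `|r - 1| ^+ 3.
Proof.
move=> r0.
have psi1 k : psi k 1 = 0 by rewrite /psi ln1 subrr; ring.
have psi0E : r * ln r - (r - 1) - (r - 1) ^+ 2 / 2 = psi 0 r by rewrite /psi; ring.
have psiE : psi 8 r = psi 0 r + 8 * (r - 1) ^+ 3 by rewrite /psi; ring.
have d0 c : 0 < c -> dpsi 0 c <= 0 by move=> /ln_le_sub1 ?; rewrite /dpsi; lra.
have d8 c : 2^-1 <= c -> 0 <= dpsi 8 c.
  move=> c2; have c0 : 0 < c by apply: lt_le_trans c2; lra.
  have := ln_ge_1subV c0; have cV : c^-1 <= 2 by rewrite -[2]invrK lef_pV2 // posrE invr_gt0.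
  have -> : 1 - c^-1 = (c - 1) - (c - 1) ^+ 2 * c^-1 by field; exact: lt0r_neq0.
  have : (c - 1) ^+ 2 * c^-1 <= (c - 1) ^+ 2 * 2 by rewrite ler_wpM2l ?sqr_ge0.
  by have := sqr_ge0 (c - 1); rewrite /dpsi; lra.
rewrite psi0E.
have [r1|r1|->] := ltgtP r 1; last by rewrite psi1 normr0 mulr_ge0 // exprn_ge0.
- rewrite (ltr0_norm (_ : r - 1 < 0)) ?subr_lt0 //.
  have -> : (- (r - 1)) ^+ 3 = - (r - 1) ^+ 3 by ring.
  have psi_ge0 : 0 <= psi 0 r.
    have [c /andP[rc _]] := psi_MVT 0 r0 r1; rewrite psi1 sub0r => E.
    by rewrite -oppr_le0 E mulr_le0_ge0 ?d0 ?subr_ge0 ?(ltW r1) // (lt_trans r0).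
  rewrite ger0_norm //.
  have [r2|r2] := leP 2^-1 r.
    have [c /andP[rc _]] := psi_MVT 8 r0 r1; rewrite psi1 sub0r psiE => E.
    have : 0 <= dpsi 8 c * (1 - r).
      by rewrite mulr_ge0 ?d8 ?subr_ge0 ?(ltW r1) // (le_trans r2) // ltW.
    by rewrite -E; lra.
  (* Below 1/2 a crude bound suffices: the remainder is at most 1, while 8(1 - r)^3 is at least
     1. *)
  have rlnr : r * ln r <= 0 by rewrite mulr_ge0_le0 ?ltW // ln_lt0 // r0.
  have := sqr_ge0 (r - 1).
  have : 1 <= - (8 * (r - 1) ^+ 3).
    have -> : - (8 * (r - 1) ^+ 3) = (2 * (1 - r)) ^+ 3 by ring.
    by apply: exprn_ege1; lra.
  by rewrite -psi0E; lra.
- rewrite (gtr0_norm (_ : 0 < r - 1)) ?subr_gt0 //.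
  have [c /andP[c1 _]] := psi_MVT 0 ltr01 r1; rewrite psi1 subr0 => E.
  have psi_le0 : psi 0 r <= 0.
    by rewrite E mulr_le0_ge0 ?d0 ?subr_ge0 ?(ltW r1) // (lt_trans ltr01).
  have [c' /andP[c'1 _]] := psi_MVT 8 ltr01 r1; rewrite psi1 subr0 psiE => E'.
  have : 0 <= dpsi 8 c' * (r - 1).
    by rewrite mulr_ge0 ?d8 ?subr_ge0 ?(ltW r1) //; lra.
  by rewrite -E' ler0_norm //; lra.
Qed.

(** exp x lies between 1 + x and 1/(1 - x) = 1 + x + x^2/(1 - x), and 1 - x >= 1/2. *)
Lemma expR_taylor x : `|x| <= 2^-1 -> `|expR x - 1 - x| <= 2 * x ^+ 2.
Proof.
move=> x2; have /andP[xl xu] : - 2^-1 <= x <= 2^-1 by rewrite -ler_norml.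
have := expR_ge1Dx x; have := expR_ge1Dx (- x); rewrite expRN => EN E.
rewrite ger0_norm; last by lra.
have x1 : 0 < 1 - x by lra.
have eV : expR x <= (1 - x)^-1 by rewrite -[expR x]invrK lef_pV2 // posrE invr_gt0 expR_gt0.
have xV : (1 - x)^-1 <= 2 by rewrite -[2]invrK lef_pV2 ?posrE ?invr_gt0 //; lra.
have -> : 2 * x ^+ 2 = x ^+ 2 * 2 by ring.
have : x ^+ 2 * (1 - x)^-1 <= x ^+ 2 * 2 by rewrite ler_wpM2l ?sqr_ge0.
have -> : x ^+ 2 * (1 - x)^-1 = (1 - x)^-1 - 1 - x by field; exact: lt0r_neq0.
by lra.
Qed.

Lemma young_pair (l x y : R) : 0 < l -> x * y <= (l * x ^+ 2 + y ^+ 2 / l) / 2.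
Proof.
move=> l0; rewrite -subr_ge0.
have -> : (l * x ^+ 2 + y ^+ 2 / l) / 2 - x * y = (l * x - y) ^+ 2 / (2 * l).
  by field; exact: lt0r_neq0.
by rewrite divr_ge0 ?sqr_ge0 // mulr_ge0 // ltW.
Qed.

(** With r = a/b, [xlnx_taylor] leaves errors of third order in absolute value; Young's inequality
    with weight [l] turns them into even powers, which are polynomials and can be integrated. Where
    b < 1/2, a <= K b bounds the left side and (b - 1)^4 >= 1/16 absorbs it. *)
Lemma divergence_taylor (a b K l : R) :
  0 < a -> 0 < b -> a <= K * b -> 1 <= K -> 0 < l <= 1 ->
  `|a * ln (a / b) - (a - b) - (a - b) ^+ 2 / 2| <=
  17 * l * (a - b) ^+ 2 + 80 * K ^+ 3 / l * ((a - b) ^+ 4 + (b - 1) ^+ 4).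
Proof.
move=> a0 b0 aKb K1 /andP[l0 l1].
have bn0 := lt0r_neq0 b0.
have K30 : 1 <= K ^+ 3 by apply: exprn_ege1.
pose e := `|a - b|; pose t := `|b - 1|.
have e0 : 0 <= e by exact: normr_ge0.
have t0 : 0 <= t by exact: normr_ge0.
have e2 : (a - b) ^+ 2 = e ^+ 2 by rewrite /e real_normK ?num_real.
have e4 : (a - b) ^+ 4 = e ^+ 4 by rewrite (exprM _ 2 2) e2 -exprM.
have t4 : (b - 1) ^+ 4 = t ^+ 4.
  by rewrite (exprM _ 2 2) -[(b - 1) ^+ 2]real_normK ?num_real // -exprM.
(* Scaling by b produces (a - b)^2 / b; replacing it by (a - b)^2 costs the second term. *)
have le1 : `|a * ln (a / b) - (a - b) - (a - b) ^+ 2 / 2| <=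
    8 * e ^+ 3 / b ^+ 2 + e ^+ 2 * t / (2 * b).
  set r := a / b; have r0 : 0 < r by rewrite divr_gt0.
  have -> : a * ln r - (a - b) - (a - b) ^+ 2 / 2 =
      b * (r * ln r - (r - 1) - (r - 1) ^+ 2 / 2) - (a - b) ^+ 2 * (b - 1) / (2 * b).
    by rewrite /r; field.
  apply: le_trans (ler_normB _ _) _; apply: lerD.
    rewrite normrM (gtr0_norm b0).
    apply: le_trans (ler_wpM2l (ltW b0) (xlnx_taylor r0)) _.
    have -> : r - 1 = (a - b) / b by rewrite /r; field.
    by rewrite normrM normfV (gtr0_norm b0) -/e le_eqVlt; apply/orP; left; apply/eqP; field.
  rewrite normrM normfV normrM normrX -/t -/e (gtr0_norm (_ : 0 < 2 * b)) //.
  by rewrite mulr_gt0.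
apply: le_trans le1 _; rewrite e2 e4 t4.
have lV : 1 <= l^-1 by rewrite invr_ge1 // unitfE gt_eqF.
(* For b >= 1/2, [young_pair] gives [l * e ^+ 2] the coefficient 32/2 + 1/2 <= 17. *)
have [b2|b2] := leP 2^-1 b.
  have bV : b^-1 <= 2 by rewrite -[2]invrK lef_pV2 // posrE invr_gt0.
  have bV0 : 0 <= b^-1 by rewrite invr_ge0 ltW.
  have i1 : 8 * e ^+ 3 / b ^+ 2 <= 32 * (e * e ^+ 2).
    have -> : 32 * (e * e ^+ 2) = 8 * e ^+ 3 * 2 ^+ 2 by ring.
    rewrite -exprVn ler_wpM2l ?mulr_ge0 ?exprn_ge0 // lerXn2r ?nnegrE //.
  have i2 : e ^+ 2 * t / (2 * b) <= e * (e * t).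
    have -> : e ^+ 2 * t / (2 * b) = e * (e * t) * (b^-1 / 2) by field.
    by rewrite ler_piMr ?mulr_ge0 //; lra.
  have y1 := young_pair e (e ^+ 2) l0; have y2 := young_pair e (e * t) l0.
  have i3 : (e * t) ^+ 2 / l <= (e ^+ 4 + t ^+ 4) / 2 / l.
    rewrite ler_pM2r ?invr_gt0 // -subr_ge0.
    have -> : (e ^+ 4 + t ^+ 4) / 2 - (e * t) ^+ 2 = (e ^+ 2 - t ^+ 2) ^+ 2 / 2 by field.
    by rewrite divr_ge0 ?sqr_ge0.
  have i4 : 17 / l * (e ^+ 4 + t ^+ 4) <= 80 * K ^+ 3 / l * (e ^+ 4 + t ^+ 4).
    rewrite ler_wpM2r ?addr_ge0 ?exprn_ge0 // ler_pM2r ?invr_gt0 //; lra.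
  have i5 : 0 <= t ^+ 4 / l by rewrite divr_ge0 ?exprn_ge0 // ltW.
  have i6 : 0 <= e ^+ 4 / l by rewrite divr_ge0 ?exprn_ge0 // ltW.
  have i7 : 0 <= l * e ^+ 2 by rewrite mulr_ge0 ?exprn_ge0 // ltW.
  have y1' : (e ^+ 2) ^+ 2 / l = e ^+ 4 / l by rewrite -exprM.
  have i3' : (e ^+ 4 + t ^+ 4) / 2 / l = (e ^+ 4 / l + t ^+ 4 / l) / 2 by field; exact: lt0r_neq0.
  have i4' : 17 / l * (e ^+ 4 + t ^+ 4) = 17 * (e ^+ 4 / l) + 17 * (t ^+ 4 / l).
    by field; exact: lt0r_neq0.
  rewrite y1' in y1; rewrite i3' in i3; rewrite i4' in i4.
  apply: le_trans (lerD i1 i2) _.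
  apply: le_trans (_ : _ <= 17 * l * e ^+ 2 + (17 * (e ^+ 4 / l) + 17 * (t ^+ 4 / l))) _; last first.
    by rewrite lerD2l.
  by lra.
have eKb : e <= K * b.
  rewrite /e ler_norml; apply/andP; split; last by lra.
  have : b <= K * b by rewrite ler_peMl // ltW.
  by lra.
have i1 : 8 * e ^+ 3 / b ^+ 2 <= 4 * K ^+ 3.
  rewrite ler_pdivrMr ?exprn_gt0 //.
  have h : e ^+ 3 <= (K * b) ^+ 3 by rewrite lerXn2r ?nnegrE // mulr_ge0 ?ltW // (lt_le_trans ltr01).
  have hb : K ^+ 3 * b ^+ 2 * b <= K ^+ 3 * b ^+ 2 * 2^-1.
    by rewrite ler_wpM2l ?ltW // mulr_gt0 ?exprn_gt0 // (lt_le_trans ltr01).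
  have E : (K * b) ^+ 3 = K ^+ 3 * b ^+ 2 * b by ring.
  by rewrite E in h; lra.
have i2 : e ^+ 2 * t / (2 * b) <= K ^+ 3.
  rewrite ler_pdivrMr ?mulr_gt0 //.
  have t1 : t <= 1 by rewrite /t ler_norml; apply/andP; split; lra.
  have h : e ^+ 2 <= (K * b) ^+ 2 by rewrite lerXn2r ?nnegrE // mulr_ge0 ?ltW // (lt_le_trans ltr01).
  apply: le_trans (_ : e ^+ 2 * t <= e ^+ 2 * 1) _; first by rewrite ler_wpM2l ?exprn_ge0.
  rewrite mulr1; apply: le_trans h _.
  have -> : (K * b) ^+ 2 = K ^+ 2 * b * b by ring.
  rewrite [leRHS]mulrA ler_pM2r //.
  have : K ^+ 2 * b <= K ^+ 2 * 1 by rewrite ler_wpM2l ?sqr_ge0 //; lra.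
  have : K ^+ 2 * 1 <= K ^+ 2 * K by rewrite ler_wpM2l ?sqr_ge0.
  rewrite -exprSr; lra.
(* As |b - 1| >= 1/2, the quotient 80/16 = 5 covers the 4 of [i1] and the 1 of [i2]. *)
have i3 : 5 * K ^+ 3 <= 80 * K ^+ 3 / l * (e ^+ 4 + t ^+ 4).
  have t4' : 16^-1 <= e ^+ 4 + t ^+ 4.
    have t2 : 2^-1 <= t by rewrite /t ltr0_norm; lra.
    have : (2^-1) ^+ 4 <= t ^+ 4 by rewrite lerXn2r ?nnegrE // invr_ge0.
    rewrite exprVn -natrX; have := exprn_ge0 4 e0.
    by rewrite -[(2 ^ 4)%N]/16%N; lra.
  have : 80 * K ^+ 3 * 1 <= 80 * K ^+ 3 / l by rewrite ler_wpM2l //; lra.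
  move=> h; apply: le_trans (ler_pM _ _ h t4'); lra.
have : 0 <= 17 * l * e ^+ 2 by rewrite !mulr_ge0 ?exprn_ge0 // ltW.
lra.
Qed.

End LogTaylor.

(** * Power mean inequalities *)

Section PowerSums.
Variables (R : realFieldType) (I : finType).
Implicit Types z : I -> R.

(** Sum z_i z_j <= (z_i^2 + z_j^2)/2 over all pairs. *)
Lemma sqr_sum_le z : (\sum_i z i) ^+ 2 <= #|I|%:R * \sum_i z i ^+ 2.
Proof.
have -> : #|I|%:R * \sum_i z i ^+ 2 = \sum_i \sum_j (z i ^+ 2 + z j ^+ 2) / 2.
  under [RHS]eq_bigr do rewrite -mulr_suml big_split /= sumr_const.
  by rewrite -mulr_suml big_split /= sumr_const sumrMnl -mulr2n -[X in _ = X / 2]mulr_natr mulfK // mulr_natl.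
rewrite expr2 mulr_suml; apply: ler_sum => i _; rewrite mulr_sumr.
apply: ler_sum => j _; rewrite -subr_ge0.
have -> : (z i ^+ 2 + z j ^+ 2) / 2 - z i * z j = (z i - z j) ^+ 2 / 2 by field.
by rewrite divr_ge0 ?sqr_ge0.
Qed.

Lemma exp4_sum_le z : (\sum_i z i) ^+ 4 <= #|I|%:R ^+ 3 * \sum_i z i ^+ 4.
Proof.
rewrite (exprM _ 2 2).
have s0 : 0 <= \sum_i z i ^+ 2 by apply: sumr_ge0 => i _; exact: sqr_ge0.
apply: le_trans (_ : (#|I|%:R * \sum_i z i ^+ 2) ^+ 2 <= _).
  by rewrite lerXn2r ?nnegrE ?sqr_ge0 ?mulr_ge0 // sqr_sum_le.
rewrite exprMn (exprSr _ 2) -mulrA ler_wpM2l ?sqr_ge0 //.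
apply: le_trans (sqr_sum_le _) _; rewrite ler_wpM2l //.
by apply: ler_sum => i _; rewrite -exprM.
Qed.

End PowerSums.

(** * Exponential tilts of the Gaussian density *)

Section GaussianTilt.
Variables (R : realType) (N : nat) (N0 : R).
Hypothesis N00 : 0 < N0.
Implicit Types (a b y : 'rV[R]_N).

Definition dot a b : R := \sum_(n < N) a 0 n * b 0 n.

(* Likelihood ratio between the noise density centred at [a] and at 0. *)
Definition tilt a y : R := expR ((2 * dot y a - dot a a) / N0).

Lemma gauss_gt0 y : 0 < gauss N0 y.
Proof.
apply: prodr_gt0 => n _.
by rewrite mulr_gt0 ?expR_gt0 // invr_gt0 sqrtr_gt0 mulr_gt0 // pi_gt0.
Qed.

Lemma gauss_tilt a y : gauss N0 (y - a) = gauss N0 y * tilt a y.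
Proof.
have -> : tilt a y = \prod_(n < N) expR ((2 * (y 0 n * a 0 n) - a 0 n * a 0 n) / N0).
  by rewrite -expR_sum /tilt /dot mulr_sumr -sumrB mulr_suml.
rewrite /gauss -big_split /=; apply: eq_bigr => n _.
rewrite -mulrA -expRD !mxE; congr (_ * expR _); field; exact: lt0r_neq0.
Qed.

Lemma dotC a b : dot a b = dot b a.
Proof. by apply: eq_bigr => n _; rewrite mulrC. Qed.

Lemma dotDr a b c : dot a (b + c) = dot a b + dot a c.
Proof. by rewrite /dot -big_split; apply: eq_bigr => n _; rewrite mxE mulrDr. Qed.

Lemma dotZr (c : R) a b : dot a (c *: b) = c * dot a b.
Proof. by rewrite /dot mulr_sumr; apply: eq_bigr => n _; rewrite mxE mulrCA. Qed.

(** Products of tilts are again tilts up to a constant, so every polynomial in tilts has an explicit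
    Gaussian integral. *)
Lemma tiltM a b y :
  tilt a y * tilt b y = expR (2 * dot a b / N0) * tilt (a + b) y.
Proof.
rewrite /tilt -!expRD; congr expR; rewrite !dotDr ![dot (a + b) _]dotC !dotDr (dotC b a).
by field; exact: lt0r_neq0.
Qed.

Lemma tiltX (k : nat) a y :
  tilt a y ^+ k = expR (k%:R * (k%:R - 1) * (dot a a / N0)) * tilt (k%:R *: a) y.
Proof.
rewrite /tilt -expRD -expRM_natl; congr expR.
rewrite !dotZr [dot (_ *: a) a]dotC !dotZr; field; exact: lt0r_neq0.
Qed.

Lemma hasint_tilt a : hasint (fun y => gauss N0 y * tilt a y) 1.
Proof. by apply: hasint_ext (hasint_gauss a N00) => y; rewrite gauss_tilt. Qed.

Lemma hasint_tiltM a b :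
  hasint (fun y => gauss N0 y * (tilt a y * tilt b y)) (expR (2 * dot a b / N0)).
Proof.
rewrite -[expR _]mulr1; apply: hasint_ext (hasintZ _ (hasint_tilt (a + b))) => y.
by rewrite tiltM mulrCA.
Qed.

Lemma hasint_tiltX (k : nat) a :
  hasint (fun y => gauss N0 y * tilt a y ^+ k)
         (expR (k%:R * (k%:R - 1) * (dot a a / N0))).
Proof.
rewrite -[expR _]mulr1; apply: hasint_ext (hasintZ _ (hasint_tilt (k%:R *: a))) => y.
by rewrite tiltX mulrCA.
Qed.

(** The fourth moment of [tilt a - 1] under the noise, with v = |a|^2 / N0; the constant -3 is -4 +
    1, from the powers one and zero. *)
Definition tilt4 (v : R) : R := expR (12 * v) - 4 * expR (6 * v) + 6 * expR (2 * v) - 3.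

Lemma hasint_tilt4 a :
  hasint (fun y => gauss N0 y * (tilt a y - 1) ^+ 4) (tilt4 (dot a a / N0)).
Proof.
set v := dot a a / N0.
have h := hasintD (hasint_tiltX 4 a) (hasintD (hasintZ (- 4) (hasint_tiltX 3 a))
  (hasintD (hasintZ 6 (hasint_tiltX 2 a)) (hasintD (hasintZ (- 4) (hasint_tiltX 1 a))
    (hasint_tiltX 0 a)))).
rewrite (_ : tilt4 v = expR (4%:R * (4%:R - 1) * v) +
  (- 4 * expR (3%:R * (3%:R - 1) * v) + (6 * expR (2%:R * (2%:R - 1) * v) +
  (- 4 * expR (1%:R * (1%:R - 1) * v) + expR (0%:R * (0%:R - 1) * v))))).
  by apply: hasint_ext h => y; ring.
rewrite /tilt4.
have -> : 4%:R * (4%:R - 1) * v = 12 * v by ring.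
have -> : 3%:R * (3%:R - 1) * v = 6 * v by ring.
have -> : 2%:R * (2%:R - 1) * v = 2 * v by ring.
have -> : 1%:R * (1%:R - 1) * v = 0 by ring.
have -> : 0%:R * (0%:R - 1) * v = 0 by ring.
by rewrite expR0; ring.
Qed.

(* The constant and linear terms of the expansion in [v] cancel. *)
Lemma tilt4_le (v w : R) : `|2 * v| <= w -> w <= 12^-1 -> tilt4 v <= 156 * w ^+ 2.
Proof.
move=> vw w12.
(* Used for k = 6, 3, 1, whence 156 = 2(36 + 4 x 9 + 6); w <= 1/12 keeps k w <= 1/2. *)
have bound (k : R) : 0 <= k -> k <= 6 ->
    `|expR (k * (2 * v)) - 1 - k * (2 * v)| <= 2 * k ^+ 2 * w ^+ 2.
  move=> k0 k6; have kw : `|k * (2 * v)| <= k * w by rewrite normrM ger0_norm // ler_wpM2l.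
  have w0 : 0 <= w by apply: le_trans vw.
  apply: le_trans (expR_taylor _) _.
    apply: le_trans kw _; apply: le_trans (ler_wpM2r w0 k6) _; lra.
  rewrite -mulrA ler_pM2l // -exprMn -[leLHS]real_normK ?num_real //.
  by rewrite lerXn2r ?nnegrE // mulr_ge0.
have := bound 6 ltac:(lra) ltac:(lra); have := bound 3 ltac:(lra) ltac:(lra).
have := bound 1 ltac:(lra) ltac:(lra).
rewrite /tilt4.
have -> : 6 * (2 * v) = 12 * v by ring.
have -> : 3 * (2 * v) = 6 * v by ring.
have -> : 1 * (2 * v) = 2 * v by ring.
rewrite !ler_norml => /andP[a1 a2] /andP[b1 b2] /andP[c1 c2].
lra.
Qed.

End GaussianTilt.

(** * Divergence between two mixtures of shifted Gaussians *)

Section MixtureDivergence.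
Variables (R : realType) (N : nat) (N0 : R) (I : finType).
Variables (a : I -> 'rV[R]_N) (c1 c0 : I -> R) (K : R).
Hypothesis N00 : 0 < N0.
Hypothesis c1_ge0 : forall i, 0 <= c1 i.
Hypothesis c0_gt0 : forall i, 0 < c0 i.
Hypothesis c1_sum : \sum_i c1 i = 1.
Hypothesis c0_sum : \sum_i c0 i = 1.
Hypothesis c1_le : forall i, c1 i <= K * c0 i.
Hypothesis K_ge1 : 1 <= K.

Let mix (c : I -> R) (y : 'rV[R]_N) : R := \sum_i c i * gauss N0 (y - a i).
Let kl (y : 'rV[R]_N) : R := mix c1 y * log2 (mix c1 y / mix c0 y).
Let M : R := #|I|%:R.
Let q i := c1 i - c0 i.

Lemma mixture_gt0 (c : I -> R) y : (forall i, 0 <= c i) -> \sum_i c i = 1 ->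
  0 < \sum_i c i * gauss N0 (y - a i).
Proof.
move=> c_ge0 c_sum; have nn i : true -> 0 <= c i * gauss N0 (y - a i).
  by move=> _; rewrite mulr_ge0 // ltW // gauss_gt0.
rewrite lt_neqAle sumr_ge0 // andbT eq_sym psumr_eq0 //.
apply/negP => /allP z; have : \sum_i c i = 0.
  apply: big1 => i _; have := z i (mem_index_enum _).
  by rewrite mulf_eq0 (gt_eqF (gauss_gt0 _ _)) // orbF => /eqP.
by move/eqP; rewrite c_sum oner_eq0.
Qed.

Lemma hasint_mixture (c : I -> R) :
  hasint (fun y => \sum_i c i * gauss N0 (y - a i)) (\sum_i c i).
Proof.
apply: hasint_sum => i; rewrite -[c i]mulr1.
by apply: hasint_ext (hasintZ _ (hasint_gauss (a i) N00)) => y; rewrite mulr1.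
Qed.

Let ln2_gt0 : 0 < ln 2 :> R. Proof. by rewrite ln_gt0 // ltr1n. Qed.

Let ln2_kl y : ln 2 * kl y = mix c1 y * ln (mix c1 y / mix c0 y).
Proof. by rewrite /kl /log2 mulrCA [ln 2 * _]mulrC divfK // gt_eqF. Qed.

Let c0_ge0 i : 0 <= c0 i. Proof. exact: ltW. Qed.

Let mix_le y : mix c1 y <= K * mix c0 y.
Proof.
rewrite /mix mulr_sumr; apply: ler_sum => i _; rewrite mulrA.
by rewrite ler_wpM2r // ltW // gauss_gt0.
Qed.

(** Integrate a - b <= a ln(a/b) <= a ln K, where the mixtures a and b have total mass one. *)
Lemma mixture_divergence_bounded : 0 <= ln 2 * intRN kl <= ln K.
Proof.
have hlo := hasintD (hasint_mixture c1) (hasintZ (- 1) (hasint_mixture c0)).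
have hhi := hasintZ (ln K) (hasint_mixture c1).
rewrite c1_sum c0_sum mulr1 subrr in hlo; rewrite c1_sum mulr1 in hhi.
apply: hasint_between ln2_gt0 hlo hhi _ => y.
rewrite -/(mix c1 y) -/(mix c0 y) ln2_kl.
have A0 : 0 < mix c1 y by exact: mixture_gt0.
have B0 : 0 < mix c0 y by exact: mixture_gt0.
apply/andP; split.
  have := ln_ge_1subV (divr_gt0 A0 B0).
  move=> /(ler_wpM2l (ltW A0)); apply: le_trans.
  by rewrite invf_div mulrBr mulrCA divff ?gt_eqF // mulN1r !mulr1.
rewrite mulrC ler_pM2r // ler_ln ?posrE ?divr_gt0 // ?(lt_le_trans ltr01) //.
by rewrite ler_pdivrMr.
Qed.

Let q_sum : \sum_i q i = 0. Proof. by rewrite sumrB c1_sum c0_sum subrr. Qed.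

Let c_le1 (c : I -> R) i : (forall i, 0 <= c i) -> \sum_i c i = 1 -> c i <= 1.
Proof.
move=> c_ge0 <-; rewrite (bigD1 i) //= lerDl; exact: sumr_ge0.
Qed.

Let q_le1 i : `|q i| <= 1.
Proof.
have := c_le1 i c1_ge0 c1_sum; have := c_le1 i c0_ge0 c0_sum.
have := c1_ge0 i; have := c0_ge0 i; rewrite /q ler_norml => *.
by apply/andP; split; lra.
Qed.

Let exp4_tilt_sum_le (c : I -> R) y : (forall i, `|c i| <= 1) ->
  (\sum_i c i * (tilt N0 (a i) y - 1)) ^+ 4 <=
  M ^+ 3 * \sum_i (tilt N0 (a i) y - 1) ^+ 4.
Proof.
move=> cle; apply: le_trans (exp4_sum_le _) _; rewrite ler_wpM2l ?exprn_ge0 //.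
apply: ler_sum => i _; rewrite exprMn ler_piMl //.
  by rewrite (exprM _ 2 2) sqr_ge0.
by rewrite -[c i ^+ 4]ger0_norm ?(exprM _ 2 2) ?sqr_ge0 // -exprM normrX exprn_ile1.
Qed.

(** In 35, the square in the error takes 34 and the linearisation of [Q] takes 1; 160 comes from the
    fourth powers and 156 from [tilt4_le]. *)
Definition divergence_cst : R := 35 * M ^+ 2 + 160 * 156 * K ^+ 3 * M ^+ 4.

Lemma divergence_cst_ge0 : 0 <= divergence_cst.
Proof.
have K0 : 0 <= K by exact: le_trans K_ge1.
have M0 : 0 <= M by rewrite /M.
apply: addr_ge0; first exact: mulr_ge0 (exprn_ge0 _ M0).
exact: mulr_ge0 (mulr_ge0 (mulr_ge0 _ _) (exprn_ge0 _ K0)) (exprn_ge0 _ M0).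
Qed.

(** After the noise density is factored out, [divergence_taylor] sandwiches the integrand between
    polynomials in tilts. The linear term integrates to 0, half the quadratic one to the main term
    up to O(w^2), and the fourth powers to O(w^2); [l] stays free to balance the errors. *)
Lemma mixture_divergence_taylor (w l : R) :
  (forall i j, `|2 * dot (a i) (a j) / N0| <= w) -> w <= 12^-1 -> 0 < l <= 1 ->
  `|ln 2 * intRN kl - dot (\sum_i q i *: a i) (\sum_i q i *: a i) / N0| <=
  divergence_cst * (l * w + w ^+ 2 / l).
Proof.
move=> hw w12 /andP[l0 l1].
have K0 : 0 <= K by exact: le_trans K_ge1.
have [i0 _] : exists i0 : I, True.
  apply: contrapT => /forallNP noI; move: c1_sum.
  by rewrite big1 => [/eqP|i]; [rewrite eq_sym oner_eq0|case: (noI i)].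
have w0 : 0 <= w by apply: le_trans (normr_ge0 _) (hw i0 i0).
pose t i y := tilt N0 (a i) y.
pose g y := gauss N0 (y : 'rV[R]_N).
pose D y := \sum_i q i * t i y.
pose C2 := 160 * K ^+ 3 * M ^+ 3.
pose Q := \sum_i \sum_j q i * q j * expR (2 * dot (a i) (a j) / N0).
pose S4 := \sum_i tilt4 (dot (a i) (a i) / N0).
have h1 : hasint (fun y => g y * D y) 0.
  rewrite -q_sum; apply: hasint_ext (hasint_mixture q) => y.
  by rewrite /D mulr_sumr; apply: eq_bigr => i _; rewrite gauss_tilt // mulrCA.
have h2 : hasint (fun y => g y * D y ^+ 2) Q.
  have : hasint (fun y => \sum_i \sum_j q i * q j * (g y * (t i y * t j y))) Q.
    by apply: hasint_sum => i; apply: hasint_sum => j; apply/hasintZ/hasint_tiltM.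
  apply: hasint_ext => y; rewrite /D expr2 mulr_suml mulr_sumr; apply: eq_bigr => i _.
  by rewrite !mulr_sumr; apply: eq_bigr => j _; ring.
have h4 : hasint (fun y => g y * \sum_i (t i y - 1) ^+ 4) S4.
  have : hasint (fun y => \sum_i g y * (t i y - 1) ^+ 4) S4.
    by apply: hasint_sum => i; exact: hasint_tilt4.
  by apply: hasint_ext => y; rewrite mulr_sumr.
have hE := hasintD (hasintZ (17 * l) h2) (hasintZ (C2 / l) h4).
have hm := hasintD h1 (hasintZ 2^-1 h2).
have hlo := hasintD hm (hasintZ (- 1) hE).
have hhi := hasintD hm hE.
have between y : g y * D y + 2^-1 * (g y * D y ^+ 2) +
      -1 * (17 * l * (g y * D y ^+ 2) + C2 / l * (g y * \sum_i (t i y - 1) ^+ 4))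
      <= ln 2 * kl y <=
    g y * D y + 2^-1 * (g y * D y ^+ 2) +
      (17 * l * (g y * D y ^+ 2) + C2 / l * (g y * \sum_i (t i y - 1) ^+ 4)).
  have g0 : 0 < g y by exact: gauss_gt0.
  pose A := \sum_i c1 i * t i y; pose B := \sum_i c0 i * t i y.
  have mixE c : mix c y = g y * \sum_i c i * t i y.
    by rewrite /mix mulr_sumr; apply: eq_bigr => i _; rewrite gauss_tilt // mulrCA.
  have A0 : 0 < A by rewrite -(pmulr_rgt0 _ g0) -mixE; exact: mixture_gt0.
  have B0 : 0 < B by rewrite -(pmulr_rgt0 _ g0) -mixE; exact: mixture_gt0.
  have AB : A <= K * B by have := mix_le y; rewrite !mixE mulrCA ler_pM2l.
  have klE : ln 2 * kl y = g y * (A * ln (A / B)).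
    by rewrite ln2_kl !mixE -/A -/B -mulf_div divff ?gt_eqF // mul1r mulrA.
  have DE : A - B = D y.
    by rewrite /A /B /D -sumrB; apply: eq_bigr => i _; rewrite /q mulrBl.
  (* Since [q] sums to 0, each tilt may be lowered by 1, which makes the fourth power small; for
     [B - 1] the weights sum to 1 instead. *)
  have D4 : (A - B) ^+ 4 <= M ^+ 3 * \sum_i (t i y - 1) ^+ 4.
    rewrite DE (_ : D y = \sum_i q i * (t i y - 1)); first exact: exp4_tilt_sum_le.
    under [RHS]eq_bigr do rewrite mulrBr mulr1.
    by rewrite sumrB q_sum subr0.
  have B4 : (B - 1) ^+ 4 <= M ^+ 3 * \sum_i (t i y - 1) ^+ 4.
    rewrite (_ : B - 1 = \sum_i c0 i * (t i y - 1)).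
      apply: exp4_tilt_sum_le => i; rewrite ger0_norm //; exact: c_le1.
    under [RHS]eq_bigr do rewrite mulrBr mulr1.
    by rewrite sumrB c0_sum.
  have := divergence_taylor A0 B0 AB K_ge1 (introT andP (conj l0 l1)).
  set Z := A * ln _ - _ - _; rewrite DE => ZE.
  have : 80 * K ^+ 3 / l * (D y ^+ 4 + (B - 1) ^+ 4) <=
      C2 / l * \sum_i (t i y - 1) ^+ 4.
    have -> : C2 / l * \sum_i (t i y - 1) ^+ 4 = 80 * K ^+ 3 / l *
        (M ^+ 3 * (\sum_i (t i y - 1) ^+ 4) + M ^+ 3 * \sum_i (t i y - 1) ^+ 4).
      by rewrite /C2; ring.
    rewrite ler_wpM2l ?divr_ge0 ?mulr_ge0 ?(ltW l0) //.
    by rewrite -DE lerD.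
  move=> E4; have {ZE E4} := le_trans ZE (lerD (lexx _) E4).
  rewrite ler_norml => /andP[/(ler_wpM2l (ltW g0)) zl /(ler_wpM2l (ltW g0)) zu].
  have gZ : g y * Z = ln 2 * kl y - g y * D y - 2^-1 * (g y * D y ^+ 2).
    by rewrite klE /Z -DE; field.
  rewrite gZ in zl zu.
  apply/andP; split.
    rewrite -subr_ge0; move: zl; rewrite -subr_ge0.
    by move=> z; apply: le_trans z _; rewrite le_eqVlt; apply/orP; left; apply/eqP; ring.
  rewrite -subr_ge0; move: zu; rewrite -subr_ge0.
  by move=> z; apply: le_trans z _; rewrite le_eqVlt; apply/orP; left; apply/eqP; ring.
have /andP[] := hasint_between ln2_gt0 hlo hhi between.
rewrite !add0r mulN1r.
have M0 : 0 <= M by rewrite /M.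
have sum2_le (F : I -> I -> R) x : (forall i j, `|F i j| <= x) ->
    `|\sum_i \sum_j q i * q j * F i j| <= M ^+ 2 * x.
  move=> Fx; apply: le_trans (_ : _ <= \sum_(i : I) \sum_(j : I) x) _.
    apply: le_trans (ler_norm_sum _ _ _) _; apply: ler_sum => i _.
    apply: le_trans (ler_norm_sum _ _ _) _; apply: ler_sum => j _.
    rewrite !normrM; apply: le_trans (Fx i j); rewrite ler_piMl //.
    by rewrite mulr_ile1.
  rewrite !sumr_const -mulrnA -mulr_natl natrM; exact: lexx.
pose e i j := 2 * dot (a i) (a j) / N0.
have dotq : \sum_i \sum_j q i * q j * e i j =
    2 * (dot (\sum_i q i *: a i) (\sum_i q i *: a i) / N0).
  have dot_sumr b : dot b (\sum_i q i *: a i) = \sum_i q i * dot b (a i).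
    rewrite /dot; under eq_bigr do rewrite summxE mulr_sumr.
    rewrite exchange_big; apply: eq_bigr => i _; rewrite mulr_sumr.
    by apply: eq_bigr => n _; rewrite mxE mulrCA.
  rewrite dot_sumr mulr_suml mulr_sumr; apply: eq_bigr => i _.
  rewrite dotC dot_sumr mulr_sumr mulr_suml mulr_sumr; apply: eq_bigr => j _.
  by rewrite /e (dotC (a i)); ring.
(* The constant term of the exponentials drops out since [q] sums to 0, leaving [Q = 2 * V] up to
   second order in w. *)
have qq0 : \sum_i \sum_j q i * q j * 1 = 0.
  by rewrite big1 // => i _; under eq_bigr do rewrite mulr1; rewrite -mulr_sumr q_sum mulr0.
set V := dot _ _ / N0.
have w2 : 2 * w ^+ 2 <= w by rewrite expr2; have := ler_wpM2l w0 w12; lra.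
have e2 i j : `|expR (e i j) - 1 - e i j| <= 2 * w ^+ 2.
  apply: le_trans (expR_taylor _) _; first by apply: le_trans (hw i j) _; lra.
  rewrite ler_pM2l // -[leLHS]real_normK ?num_real // lerXn2r ?nnegrE //.
  exact: hw.
have Q1 : `|Q - 2 * V| <= M ^+ 2 * (2 * w ^+ 2).
  apply: le_trans (sum2_le _ _ e2).
  rewrite (_ : \sum_i _ = Q - 2 * V) // -dotq -[RHS]subr0 -[X in _ = _ - X]qq0.
  rewrite /Q -!sumrB; apply: eq_bigr => i _; rewrite -!sumrB.
  by apply: eq_bigr => j _; rewrite /e; ring.
have V1 : `|2 * V| <= M ^+ 2 * w by rewrite -dotq; apply: sum2_le.
have Q2 : Q <= 2 * M ^+ 2 * w.
  have := ler_wpM2l (exprn_ge0 2 M0) w2.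
  move: Q1 V1; rewrite !ler_norml => /andP[_ ?] /andP[_ ?]; lra.
have S4le : S4 <= 156 * M * w ^+ 2.
  apply: le_trans (_ : _ <= \sum_(i : I) 156 * w ^+ 2) _; last first.
    by rewrite sumr_const -[leLHS]mulr_natl mulrCA mulrA.
  by apply: ler_sum => i _; apply: tilt4_le => //; rewrite mulrA; exact: hw.
have C20 : 0 <= C2 / l.
  by rewrite divr_ge0 ?(ltW l0) // !mulr_ge0 ?exprn_ge0.
have E1 : 17 * l * Q <= 34 * M ^+ 2 * (l * w).
  by have := ler_wpM2l (mulr_ge0 (ler0n R 17) (ltW l0)) Q2; lra.
have E2 : C2 / l * S4 <= 160 * 156 * K ^+ 3 * M ^+ 4 * (w ^+ 2 / l).
  have := ler_wpM2l C20 S4le.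
  move=> h; apply: le_trans h _; rewrite le_eqVlt; apply/orP; left; apply/eqP.
  by rewrite /C2; field; exact: lt0r_neq0.
have lw : 0 <= l * w by rewrite mulr_ge0 // ltW.
have wl : w ^+ 2 <= w ^+ 2 / l.
  by rewrite ler_peMr ?sqr_ge0 // invr_ge1 ?unitfE ?gt_eqF.
have wl0 : 0 <= w ^+ 2 / l by apply: le_trans wl; exact: sqr_ge0.
have Mw := ler_wpM2l (exprn_ge0 2 M0) wl.
have Mw0 := mulr_ge0 (exprn_ge0 2 M0) wl0.
have KM : 0 <= 160 * 156 * K ^+ 3 * M ^+ 4.
  exact: mulr_ge0 (mulr_ge0 (mulr_ge0 _ _) (exprn_ge0 _ K0)) (exprn_ge0 _ M0).
have KMlw := mulr_ge0 KM lw.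
have Mlw := mulr_ge0 (exprn_ge0 2 M0) lw.
have cE : divergence_cst * (l * w + w ^+ 2 / l) = 35 * (M ^+ 2 * (l * w)) +
    35 * (M ^+ 2 * (w ^+ 2 / l)) + 160 * 156 * K ^+ 3 * M ^+ 4 * (l * w) +
    160 * 156 * K ^+ 3 * M ^+ 4 * (w ^+ 2 / l) by rewrite /divergence_cst; ring.
rewrite cE => lo hi; move: Q1; rewrite !ler_norml => /andP[q1 q2].
by apply/andP; split; lra.
Qed.

End MixtureDivergence.

(** * Information carried by one bit *)

Section BitInformation.
Variables (R : realType) (m N : nat) (X : 'M[R]_(2 ^ m, N)) (p : 'I_m -> R).
Hypothesis p01 : forall k, 0 < p k < 1.

(* Order of the remainder: [v * sqrt v] for small [v], while the boundedness of
   the information of one bit gives [O(v)] for large [v]. *)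
Definition rate (v : R) : R := v * Num.min 1 (Num.sqrt v).

(** Kullback-Leibler divergence, in bits, of the output law given C_k = u from the unconditional
    one; [MIbit] averages it over u. *)
Definition bit_div (N0 : R) (k : 'I_m) (u : bool) (h : 'rV[R]_N) : R :=
  intRN (fun y => pycond X p N0 k u h y *
                  log2 (pycond X p N0 k u h y / py X p N0 h y)).

Lemma pycondE (N0 : R) (k : 'I_m) (u : bool) (h y : 'rV[R]_N) :
  pycond X p N0 k u h y =
  \sum_(i < 2 ^ m) condw p k u i * gauss N0 (y - hprod h (row i X)).
Proof.
rewrite /pycond big_mkcond /=; apply: eq_bigr => i _; rewrite /condw.
by case: ifP; rewrite ?mul0r.
Qed.

Lemma condw_ge0 (k : 'I_m) (u : bool) (i : nat) : 0 <= condw p k u i.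
Proof.
rewrite /condw; case: ifP => // _.
by rewrite divr_ge0 // ltW ?Psym_gt0 ?PC_gt0.
Qed.

Lemma condw_le (k : 'I_m) (u : bool) (i : nat) :
  condw p k u i <= (PC p k u)^-1 * Psym p i.
Proof.
rewrite /condw mulrC; case: ifP => // _.
by rewrite mulr_ge0 ?invr_ge0 // ltW ?Psym_gt0 ?PC_gt0.
Qed.

Lemma PC_le1 (k : 'I_m) (u : bool) : PC p k u <= 1.
Proof.
by have /andP[p0 p1] := p01 k; case: u; rewrite /PC ?gerBl ltW.
Qed.

Lemma dot_dev (h : 'rV[R]_N) (k : 'I_m) (u : bool) :
  let z := \sum_(i < 2 ^ m) (condw p k u i - Psym p i) *: hprod h (row i X) in
  dot z z = \sum_(n < N) h 0 n ^+ 2 * cdev p (X ^~ n) k u ^+ 2.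
Proof.
apply: eq_bigr => n _; rewrite -expr2 -exprMn; congr (_ ^+ 2).
rewrite summxE /cdev mulr_sumr; apply: eq_bigr => i _.
by rewrite !mxE /dev mulrCA.
Qed.

Lemma dot_ge0 (h : 'rV[R]_N) : 0 <= dot h h.
Proof. by apply: sumr_ge0 => n _; rewrite -expr2 sqr_ge0. Qed.

Lemma weighted_sqr_le (h : 'rV[R]_N) (c : 'I_N -> R) :
  (forall n, 0 <= c n) ->
  \sum_(n < N) h 0 n ^+ 2 * c n <= dot h h * \sum_(n < N) c n.
Proof.
move=> c0; rewrite /dot mulr_suml; apply: ler_sum => n _.
rewrite -expr2 ler_wpM2l ?sqr_ge0 // (bigD1 n) //= lerDl.
by apply: sumr_ge0.
Qed.

Lemma dot_hprod_le (h : 'rV[R]_N) (i j : 'I_(2 ^ m)) :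
  `|dot (hprod h (row i X)) (hprod h (row j X))| <=
  dot h h * \sum_(n < N) \sum_(l < 2 ^ m) X l n ^+ 2.
Proof.
apply: le_trans (weighted_sqr_le h _); last first.
  by move=> n; apply: sumr_ge0 => l _; exact: sqr_ge0.
apply: le_trans (ler_norm_sum _ _ _) _; apply: ler_sum => n _.
rewrite !mxE (_ : h 0 n * X i n * (h 0 n * X j n) = h 0 n ^+ 2 * (X i n * X j n)); last by ring.
rewrite normrM ger0_norm ?sqr_ge0 // ler_wpM2l ?sqr_ge0 //.
have le_sum l : X l n ^+ 2 <= \sum_(l < 2 ^ m) X l n ^+ 2.
  by rewrite (bigD1 l) //= lerDl; apply: sumr_ge0 => l' _; exact: sqr_ge0.
have := le_sum i; have := le_sum j; set S := \sum_(l < _) _ => Sj Si.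
have := sqr_ge0 (X i n - X j n); have := sqr_ge0 (X i n + X j n).
rewrite sqrrB sqrrD !mulr2n => pos neg.
by rewrite ler_norml; apply/andP; split; lra.
Qed.

(** Two regimes. Up to [v0] the expansion applies with [l] the square root of v. Beyond [v0] the
    divergence and its main term are O(v), and [rate v] is at least [mu0 * v]. *)
Lemma bit_div_taylor (k : 'I_m) (u : bool) :
  exists2 C : R, 0 <= C & forall (N0 : R) (h : 'rV[R]_N), 0 < N0 ->
    `|ln 2 * bit_div N0 k u h -
      (\sum_(n < N) h 0 n ^+ 2 * cdev p (X ^~ n) k u ^+ 2) / N0|
    <= C * rate (dot h h / N0).
Proof.
pose K := (PC p k u)^-1.
(* The added 1 keeps [B] positive and [v0] at most 1. *)
pose B := \sum_(n < N) \sum_(l < 2 ^ m) X l n ^+ 2 + 1.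
have sum_ge0 : 0 <= \sum_(n < N) \sum_(l < 2 ^ m) X l n ^+ 2.
  by apply: sumr_ge0 => n _; apply: sumr_ge0 => l _; exact: sqr_ge0.
have B0 : 0 < B by rewrite /B; lra.
pose W := \sum_(n < N) cdev p (X ^~ n) k u ^+ 2.
have W0 : 0 <= W by apply: sumr_ge0 => n _; exact: sqr_ge0.
have K1 : 1 <= K by rewrite /K invr_ge1 ?PC_le1 ?unitfE ?gt_eqF ?PC_gt0.
(* Chosen so that w = 2 B v is at most 1/12 in the first regime. *)
pose v0 := (24 * B)^-1; have v00 : 0 < v0 by rewrite invr_gt0 mulr_gt0.
pose mu0 := Num.min 1 (Num.sqrt v0).
have mu00 : 0 < mu0 by rewrite lt_min ltr01 sqrtr_gt0.
pose Cs := divergence_cst 'I_(2 ^ m) K * (2 * B + 4 * B ^+ 2).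
pose Cl := (ln K * (24 * B) + W) / mu0.
have Cs0 : 0 <= Cs.
  apply: mulr_ge0; first exact: divergence_cst_ge0.
  by rewrite addr_ge0 // mulr_ge0 ?exprn_ge0 ?(ltW B0).
have lnK0 : 0 <= ln K by exact: ln_ge0.
have Cl0 : 0 <= Cl by rewrite divr_ge0 ?(ltW mu00) // addr_ge0 // !mulr_ge0 // ltW.
exists (Cs + Cl) => [|N0 h N00]; first by rewrite addr_ge0.
pose a (i : 'I_(2 ^ m)) := hprod h (row i X).
have N0n := lt0r_neq0 N00.
set v := dot h h / N0; have v_ge0 : 0 <= v by rewrite divr_ge0 ?dot_ge0 // ltW.
have rate_ge0 : 0 <= rate v by rewrite mulr_ge0 // le_min ler01 sqrtr_ge0.
have c1_ge0 (i : 'I_(2 ^ m)) : 0 <= condw p k u i by exact: condw_ge0.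
have c0_gt0 (i : 'I_(2 ^ m)) : 0 < Psym p i by exact: Psym_gt0.
have c1_le (i : 'I_(2 ^ m)) : condw p k u i <= K * Psym p i by exact: condw_le.
have bdE : bit_div N0 k u h = intRN (fun y =>
    (\sum_(i < 2 ^ m) condw p k u i * gauss N0 (y - a i)) *
    log2 ((\sum_(i < 2 ^ m) condw p k u i * gauss N0 (y - a i)) /
          (\sum_(i < 2 ^ m) Psym p i * gauss N0 (y - a i)))).
  by congr intRN; apply/funext => y; rewrite pycondE.
rewrite {}bdE -dot_dev.
have [vs|vl] := leP v v0.
  have w12 : 2 * B * v <= 12^-1.
    have := ler_wpM2l (_ : 0 <= 2 * B) vs; rewrite mulr_ge0 ?(ltW B0) // => /(_ isT).
    have -> : 2 * B * v0 = 12^-1 by rewrite /v0; field; exact: lt0r_neq0.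
    by [].
  have hw i j : `|2 * dot (a i) (a j) / N0| <= 2 * B * v.
    rewrite !normrM normfV (gtr0_norm N00) ger0_norm // ler_pdivrMr //.
    have -> : 2 * B * v * N0 = 2 * (dot h h * B) by rewrite /v; field.
    rewrite ler_pM2l //.
    apply: le_trans (dot_hprod_le h i j) _; rewrite ler_wpM2l ?dot_ge0 //.
    by rewrite /B lerDl.
  (* The square root of v makes l w and w^2 / l both of order v^(3/2); at v = 0 both vanish, and 1
     serves as a positive value. *)
  pose l := if v == 0 then 1 else Num.sqrt v.
  have v1 : v <= 1.
    apply: le_trans vs _; rewrite /v0 invf_le1 ?mulr_gt0 // /B; lra.
  have sv1 : Num.sqrt v <= 1 by rewrite -sqrtr1 ler_wsqrtr.
  have l01 : 0 < l <= 1.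
    rewrite /l; case: eqVneq => [_|vn]; first by rewrite ltr01 lexx.
    by rewrite sqrtr_gt0 lt_neqAle eq_sym vn v_ge0.
  have := mixture_divergence_taylor N00 c1_ge0 c0_gt0 (condw_sum p01 k u)
            (Psym_sum p) c1_le K1 hw w12 l01.
  move=> h1; apply: le_trans h1 _.
  apply: le_trans (_ : _ <= Cs * rate v) _; last first.
    by rewrite ler_wpM2r // lerDl.
  rewrite /Cs /rate -[leRHS]mulrA ler_wpM2l //.
    exact: divergence_cst_ge0.
  have -> : Num.min 1 (Num.sqrt v) = Num.sqrt v by apply/min_idPr.
  rewrite le_eqVlt; apply/orP; left; apply/eqP.
  rewrite /l; case: eqVneq => [->|vn]; first by rewrite sqrtr0; ring.
  set s := Num.sqrt v; have sn : s != 0 by rewrite sqrtr_eq0 -ltNge lt_neqAle eq_sym vn.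
  have -> : v = s ^+ 2 by rewrite sqr_sqrtr.
  by field.
have := mixture_divergence_bounded a N00 c1_ge0 c0_gt0 (condw_sum p01 k u)
            (Psym_sum p) c1_le K1.
set I := ln 2 * _ => /andP[I0 IK].
have V0 : 0 <= dot (\sum_(i < 2 ^ m) (condw p k u i - Psym p i) *: hprod h (row i X))
   (\sum_(i < 2 ^ m) (condw p k u i - Psym p i) *: hprod h (row i X)) / N0.
  by rewrite divr_ge0 ?dot_ge0 // ltW.
have VW : dot (\sum_(i < 2 ^ m) (condw p k u i - Psym p i) *: hprod h (row i X))
   (\sum_(i < 2 ^ m) (condw p k u i - Psym p i) *: hprod h (row i X)) / N0 <= W * v.
  rewrite dot_dev /v mulrA ler_pM2r ?invr_gt0 // mulrC.
  by apply: weighted_sqr_le => n; exact: sqr_ge0.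
set V := _ / N0 in V0 VW *.
(* Beyond [v0] one has 1 < 24 B v, so the constant bound becomes linear in v. *)
have lnKv : ln K <= ln K * (24 * B) * v.
  rewrite -mulrA ler_peMr // -ler_pdivrMl ?mulr_gt0 // mulr1; exact: ltW.
have : `|I - V| <= (ln K * (24 * B) + W) * v.
  by rewrite mulrDl ler_norml; apply/andP; split; lra.
move=> h1; apply: le_trans h1 _.
apply: le_trans (_ : _ <= Cl * rate v) _; last by rewrite ler_wpM2r // lerDr.
have -> : Cl * rate v =
    (ln K * (24 * B) + W) * v * (Num.min 1 (Num.sqrt v) / mu0) by rewrite /Cl /rate; ring.
rewrite ler_peMr //; first by rewrite mulr_ge0 // addr_ge0 // !mulr_ge0 // ltW.
rewrite ler_pdivlMr // mul1r /mu0.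
by rewrite le_min !ge_min lexx /= ler_wsqrtr ?orbT // ltW.
Qed.

Lemma MIbit_taylor (k : 'I_m) :
  exists2 C : R, 0 <= C & forall (N0 : R) (h : 'rV[R]_N), 0 < N0 ->
    `|ln 2 * MIbit X p N0 k h -
      (\sum_(n < N) h 0 n ^+ 2 * \sum_(u : bool) PC p k u * cdev p (X ^~ n) k u ^+ 2) / N0|
    <= C * rate (dot h h / N0).
Proof.
have [C0 C00 h0] := bit_div_taylor k false; have [C1 C10 h1] := bit_div_taylor k true.
exists (C1 + C0) => [|N0 h N00]; first exact: addr_ge0.
have -> : (\sum_(n < N) h 0 n ^+ 2 *
    \sum_(u : bool) PC p k u * cdev p (X ^~ n) k u ^+ 2) / N0 =
    \sum_(u : bool) PC p k u *
      ((\sum_(n < N) h 0 n ^+ 2 * cdev p (X ^~ n) k u ^+ 2) / N0).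
  under [RHS]eq_bigr do rewrite mulrA mulr_sumr.
  rewrite -mulr_suml exchange_big /=; congr (_ / N0); apply: eq_bigr => n _.
  by rewrite mulr_sumr; apply: eq_bigr => u _; rewrite mulrCA.
rewrite /MIbit mulr_sumr -sumrB big_bool /= [leRHS]mulrDl.
apply: le_trans (ler_normD _ _) _.
have term u C : `|ln 2 * bit_div N0 k u h -
      (\sum_(n < N) h 0 n ^+ 2 * cdev p (X ^~ n) k u ^+ 2) / N0|
    <= C * rate (dot h h / N0) ->
  `|ln 2 * (PC p k u * bit_div N0 k u h) - PC p k u *
    ((\sum_(n < N) h 0 n ^+ 2 * cdev p (X ^~ n) k u ^+ 2) / N0)|
    <= C * rate (dot h h / N0).
  move=> le; rewrite mulrCA -mulrBr normrM ger0_norm ?(ltW (PC_gt0 _ _ _)) //.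
  by apply: le_trans le; rewrite ler_piMl ?PC_le1.
exact: (lerD (term true _ (h1 _ _ N00)) (term false _ (h0 _ _ N00))).
Qed.

End BitInformation.

(** * Averaging over the fading and the slope at zero SNR *)

Section Fading.
Context (R : realType) (m N : nat) (X : 'M[R]_(2 ^ m, N)) (p : 'I_m -> R)
  (d : measure_display) (T : measurableType d) (P : probability T R)
  (H : nat -> T -> R).
Hypothesis N_gt0 : (0 < N)%N.
Hypothesis p01 : forall k : 'I_m, 0 < p k < 1.
Hypothesis H_meas : forall n, (n < N)%N -> measurable_fun setT (H n).
Hypothesis H_int : forall n, (n < N)%N ->
  P.-integrable setT (fun t => (H n t ^+ 2)%:E).
Hypothesis H_law : forall n n', (n < N)%N -> (n' < N)%N ->
  forall A : set R, measurable A -> P (H n @^-1` A) = P (H n' @^-1` A).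
Hypothesis EH2_gt0 : 0 < EH2 P H.
Hypothesis Es_gt0 : 0 < Es X p.

(** Each second moment is the integral of x^2 against a pushforward law, and these laws coincide. *)
Lemma integral_sqr_law n : (n < N)%N ->
  Rintegral P setT (fun t => H n t ^+ 2) = EH2 P H.
Proof.
move=> nN; rewrite /EH2 /Rintegral; congr fine.
have push k : (k < N)%N -> (\int[P]_t (H k t ^+ 2)%:E =
    \int[pushforward P (H k)]_x (x ^+ 2)%:E)%E.
  move=> kN; rewrite (ge0_integral_pushforward (H_meas kN)) //.
    by apply/measurable_EFinP; exact: measurable_funX.
  by move=> x _; rewrite lee_fin sqr_ge0.
rewrite !push //; apply: eq_measure_integral; [exact: H_meas..|].
by move=> ? ? A mA _; exact: H_law.
Qed.

Lemma Rintegral_sum (f : 'I_N -> T -> R) :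
  (forall n, P.-integrable setT (EFin \o f n)) ->
  Rintegral P setT (fun t => \sum_(n < N) f n t) =
  \sum_(n < N) Rintegral P setT (f n).
Proof.
move=> fi; rewrite /Rintegral sum_fine => [|n _]; last exact: (integrable_fin_num measurableT (fi n)).
rewrite -integral_sum //; congr fine; apply: eq_integral => t _.
by rewrite sumEFin.
Qed.

Lemma integrable_sumr (f : 'I_N -> T -> R) :
  (forall n, P.-integrable setT (EFin \o f n)) ->
  P.-integrable setT (EFin \o (fun t => \sum_(n < N) f n t)).
Proof.
move=> fi; rewrite (_ : _ \o _ = fun t => (\sum_(n < N) (f n t)%:E)%E).
  by apply: (integrable_sum measurableT) => n _; exact: fi.
by apply/funext => t /=; rewrite sumEFin.
Qed.

Lemma integrable_scale (c : R) (f : T -> R) :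
  P.-integrable setT (EFin \o f) -> P.-integrable setT (EFin \o (fun t => c * f t)).
Proof. exact: (integrableZl measurableT c). Qed.

(** At SNR s the noise level is N0 = [c0 / s]. *)
Let c0 := EH2 P H * Es X p.
Let c0_gt0 : 0 < c0. Proof. exact: mulr_gt0. Qed.

Let hvec t : 'rV[R]_N := \row_(n < N) H n t.
(** Normalised so that |h|^2 / N0 = [s * gain t]. *)
Let gain t : R := \sum_(n < N) H n t ^+ 2 / c0.

Let gain_ge0 t : 0 <= gain t.
Proof. by apply: sumr_ge0 => n _; rewrite divr_ge0 ?sqr_ge0 // ltW. Qed.

Let gain_int : P.-integrable setT (EFin \o gain).
Proof.
apply: integrable_sumr => n.
under [X in integrable _ _ X]eq_fun do rewrite mulrC.
by apply: integrable_scale; exact: H_int.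
Qed.

Let dot_hvec t : dot (hvec t) (hvec t) = c0 * gain t.
Proof.
rewrite /dot /gain mulr_sumr; apply: eq_bigr => n _.
by rewrite !mxE; field; exact: lt0r_neq0.
Qed.

(** The remainder divided by s: [rate (s * gain t) = s * rem s t] for the order function of the
    one-bit expansion. *)
Let rem (s : R) t : R := gain t * Num.min 1 (Num.sqrt (s * gain t)).

Let rem_ge0 s t : 0 <= rem s t.
Proof. by rewrite mulr_ge0 // le_min ler01 sqrtr_ge0. Qed.

Let rem_le s t : rem s t <= gain t.
Proof. by rewrite ler_piMr // ge_min lexx. Qed.

Let gain_meas : measurable_fun setT gain.
Proof. by apply/measurable_EFinP; exact: (measurable_int P gain_int). Qed.

Let rem_meas s : measurable_fun setT (rem s).
Proof.
apply: measurable_funM => //; apply: measurable_minr => //.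
apply: (measurableT_comp (continuous_measurable_fun (@sqrt_continuous R))).
exact: measurable_funM.
Qed.

Let rem_int s : P.-integrable setT (EFin \o rem s).
Proof.
apply: le_integrable gain_int => //; first exact/measurable_EFinP.
by move=> t _ /=; rewrite lee_fin !ger0_norm.
Qed.

(** Dominated convergence with bound [gain]; pointwise, the minimum is at most a square root tending
    to 0. *)
Let rem_cvg0 (u : R^nat) : u @ \oo --> (0 : R) ->
  Rintegral P setT (rem (u n)) @[n --> \oo] --> (0 : R).
Proof.
move=> u0.
have [||||_ _] := @dominated_convergence _ _ _ P setT measurableT
  (fun n => EFin \o rem (u n)) (cst 0%E) (EFin \o gain) _ _ _ gain_int.
- by move=> n; exact/measurable_EFinP.
- exact: measurable_cst.
- apply: aeW => t _; apply: cvg_EFin; first exact: nearW.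
  apply: (@squeeze_cvgr _ _ _ _ (cst 0) (fun n => gain t * Num.sqrt (u n * gain t))).
  + by apply: nearW => n; rewrite /= rem_ge0 ler_wpM2l // ge_min lexx orbT.
  + exact: cvg_cst.
  + have usqrt : Num.sqrt (u n * gain t) @[n --> \oo] --> Num.sqrt (0 * gain t).
      apply: (cvg_comp (fun n => u n * gain t) Num.sqrt); last exact: sqrt_continuous.
      by apply: cvgM => //; exact: cvg_cst.
    rewrite mul0r sqrtr0 in usqrt; rewrite -[X in _ --> X](mulr0 (gain t)).
    by apply: cvgM => //; exact: cvg_cst.
- apply: aeW => t n _ /=; rewrite lee_fin ger0_norm //.
- rewrite integral0 => h; exact: fine_cvg h.
Qed.

Let W k n : R := \sum_(u : bool) PC p k u * cdev p (X ^~ n) k u ^+ 2.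

Let info (k : 'I_m) (s : R) : R :=
  Rintegral P setT (fun t => MIbit X p (c0 / s) k (hvec t)).

(** The bound of [MIbit_taylor] holds for every fading value and can be integrated; divided by s,
    its error is a constant times E[rem], which tends to 0. *)
Lemma MIbit_slope (k : 'I_m) :
  info k s / s @[s --> 0^'+] --> (\sum_(n < N) W k n) / (Es X p * ln 2).
Proof.
have ln2_gt0 : 0 < ln 2 :> R by rewrite ln_gt0 // ltr1n.
have [C C0 taylor] := MIbit_taylor X p01 k.
(* Slope in nats at a given fading value; the fading moments cancel from its mean because the
   components share E[H^2]. *)
pose S t : R := \sum_(n < N) W k n / c0 * H n t ^+ 2.
have S_int : P.-integrable setT (EFin \o S).
  by apply: integrable_sumr => n; apply: integrable_scale; exact: H_int.
have IS : Rintegral P setT S = (\sum_(n < N) W k n) / Es X p.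
  rewrite Rintegral_sum => [|n]; last by apply: integrable_scale; exact: H_int.
  rewrite mulr_suml; apply: eq_bigr => n _; rewrite RintegralZl //; last exact: H_int.
  rewrite integral_sqr_law // /c0; field.
  by rewrite !gt_eqF.
pose up s t := s / ln 2 * (S t + C * rem s t).
pose lo s t := s / ln 2 * (S t - C * rem s t).
have Crem_int s : P.-integrable setT (EFin \o (fun t => C * rem s t)).
  exact: integrable_scale.
have up_int s : P.-integrable setT (EFin \o up s).
  apply: integrable_scale; exact: (integrableD measurableT S_int (Crem_int s)).
have lo_int s : P.-integrable setT (EFin \o lo s).
  apply: integrable_scale; exact: (integrableB measurableT S_int (Crem_int s)).
have Iup s : Rintegral P setT (up s) =
    s / ln 2 * (Rintegral P setT S + C * Rintegral P setT (rem s)).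
  rewrite RintegralZl // ?RintegralD // ?RintegralZl //.
  exact: (integrableD measurableT S_int (Crem_int s)).
have Ilo s : Rintegral P setT (lo s) =
    s / ln 2 * (Rintegral P setT S - C * Rintegral P setT (rem s)).
  rewrite RintegralZl // ?RintegralB // ?RintegralZl //.
  exact: (integrableB measurableT S_int (Crem_int s)).
have sandwich s : 0 < s ->
    (Rintegral P setT S - C * Rintegral P setT (rem s)) / ln 2 <= info k s / s <=
    (Rintegral P setT S + C * Rintegral P setT (rem s)) / ln 2.
  move=> s0.
  have pointwise t : lo s t <= MIbit X p (c0 / s) k (hvec t) <= up s t.
    have := taylor (c0 / s) (hvec t) (divr_gt0 c0_gt0 s0).
    rewrite dot_hvec.
    have -> : c0 * gain t / (c0 / s) = s * gain t.
      by field; rewrite !gt_eqF.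
    have -> : rate (s * gain t) = s * rem s t by rewrite /rate /rem mulrA.
    have -> : (\sum_(n < N) hvec t 0 n ^+ 2 * \sum_(u : bool) PC p k u *
        cdev p (X ^~ n) k u ^+ 2) / (c0 / s) = s * S t.
      rewrite /S mulr_suml mulr_sumr; apply: eq_bigr => n _.
      by rewrite -/(W k n) mxE; field; rewrite !gt_eqF.
    rewrite ler_norml => /andP[l r].
    have E x : s / ln 2 * x = s * x / ln 2 by rewrite mulrAC.
    rewrite /lo /up !E ler_pdivrMr // ler_pdivlMr // [_ * ln 2]mulrC.
    by apply/andP; split; lra.
  have /andP[] := Rintegral_between (lo_int s) (up_int s) pointwise.
  rewrite -/(info k s) Ilo Iup => l r.
  rewrite ler_pdivlMr // ler_pdivrMr //.
  by apply/andP; split; [apply: le_trans l|apply: le_trans r _];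
    rewrite le_eqVlt; apply/orP; left; apply/eqP; ring.
(* Passing to sequences makes the dominated convergence of [rem] applicable. *)
apply/cvg_at_rightP => u [u_gt0 u0].
have r0 := rem_cvg0 u0.
have lim (e : R) : (Rintegral P setT S + e * Rintegral P setT (rem (u n))) / ln 2
    @[n --> \oo] --> (\sum_(n < N) W k n) / (Es X p * ln 2).
  have -> : (\sum_(n < N) W k n) / (Es X p * ln 2) =
      (Rintegral P setT S + e * 0) / ln 2.
    by rewrite mulr0 addr0 IS invfM mulrA.
  apply: cvgM; last exact: cvg_cst.
  by apply: cvgD; [|apply: cvgM => //]; exact: cvg_cst.
apply: squeeze_cvgr (lim (- C)) (lim C).
by apply: nearW => n; rewrite mulNr; exact: sandwich.
Qed.

Lemma Ibicm_slope :
  (fun s => (Ibicm X p P H s - Ibicm X p P H 0) / s) @ 0^'+ -->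
  Vmain X p / (Es X p * ln 2).
Proof.
have -> : Vmain X p / (Es X p * ln 2) =
    \sum_(k < m) (\sum_(n < N) W k n) / (Es X p * ln 2).
  by rewrite /Vmain exchange_big mulr_suml.
have : \sum_(k < m) info k s / s @[s --> 0^'+] -->
    \sum_(k < m) (\sum_(n < N) W k n) / (Es X p * ln 2).
  apply: cvg_big => [|k _]; last exact: MIbit_slope.
  exact: add_continuous.
apply: cvg_trans; apply: near_eq_cvg; near=> s.
(* To the right of 0, [Ibicm] takes its positive branch, and its value at 0 is 0. *)
have s0 : 0 < s by near: s; exact: nbhs_right_gt.
by rewrite /Ibicm ltxx s0 subr0 mulr_suml.
Unshelve. all: by end_near. Qed.

(** Limits are unique, so optimality compares the slope of [Ibicm_slope] with 1 / ln 2. *)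
Lemma FOO_VmainP : FOO X p P H <-> Vmain X p = Es X p.
Proof.
have ln2_gt0 : 0 < ln 2 :> R by rewrite ln_gt0 // ltr1n.
have Esn := lt0r_neq0 Es_gt0; have ln2n := lt0r_neq0 ln2_gt0.
split=> [foo|VE]; last first.
  rewrite /FOO (_ : (ln 2)^-1 = Vmain X p / (Es X p * ln 2)).
    exact: Ibicm_slope.
  by rewrite VE invfM mulrA divff ?mul1r.
have := cvg_unique _ foo Ibicm_slope.
move=> /(_ (@norm_hausdorff _ _)) E.
have : Vmain X p / (Es X p * ln 2) * (Es X p * ln 2) = (ln 2)^-1 * (Es X p * ln 2).
  by rewrite -E.
by rewrite divfK ?mulf_neq0 // mulrCA mulVf ?mulr1.
Qed.

End Fading.

Theorem theorem8 (R : realType) (m N : nat) (X : 'M[R]_(2 ^ m, N))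
    (p : 'I_m -> R) (d : measure_display) (T : measurableType d)
    (P : probability T R) (H : nat -> T -> R) :
  (0 < m)%N -> (0 < N)%N ->
  (forall k : 'I_m, 0 < p k < 1) ->
  (forall n, (n < N)%N -> measurable_fun setT (H n)) ->
  (forall n, (n < N)%N -> P.-integrable setT (fun t => (H n t ^+ 2)%:E)) ->
  (forall n n', (n < N)%N -> (n' < N)%N -> forall A : set R, measurable A ->
      P (H n @^-1` A) = P (H n' @^-1` A)) ->
  0 < EH2 P H ->
  0 < Es X p ->
  FOO X p P H <->
  (hadamard X 0 = \sum_(k < m) (PC p k true - PC p k false) *: hadamard X (2 ^ k)
   /\ forall j, (j < 2 ^ m)%N -> j != 0%N -> (forall k : 'I_m, j != 2 ^ k)%N ->
        hadamard X j = 0).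
Proof.
move=> _ N_gt0 p01 H_meas H_int H_law EH2_gt0 Es_gt0.
(* Both sides amount to [Vmain X p = Es X p]: the main effects carry all the energy. *)
exact: iff_trans (FOO_VmainP N_gt0 p01 H_meas H_int H_law EH2_gt0 Es_gt0)
  (Vmain_EsP X p01).
Qed.
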